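(* Let $(K,|\cdot|)$ be a non-archimedean local field with ring of integers $\mathcal{O}_K$, let $e\ge 2$ be an integer that is invertible in $\mathcal{O}_K$, and let $\phi\in K(x)$ be a superattracting integral map of pole degree $e$, i.e. $\phi=f_1/f_2$ with $f_1,f_2\in\mathcal{O}_K[x]$ monic and $\deg f_1-\deg f_2=e$. Let $\alpha\in K$ with $|\alpha|>1$. Then the Galois group $\mathrm{Gal}(K_\infty(\phi,\alpha)/K)$ is non-abelian.
   Context: A non-archimedean local field is a finite extension of $\mathbb{Q}_p$ or a field isomorphic to $\mathbb{F}_q((T))$ with $q$ a power of a prime $p$, with its standard absolute value. $K_\infty(\phi,\alpha)$ is the field generated over $K$ by all iterated preimages of $\alpha$ under $\phi$, i.e. by all solutions of $\phi^n(x)=\alpha$, $n\ge 0$, where $\phi^n$ is the $n$-th iterate. *)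

(* Defs.v *)
From HB Require Import structures.
From mathcomp Require Import all_boot all_order all_algebra all_field.
From mathcomp Require Import all_classical all_reals.

Set Implicit Arguments.
Unset Strict Implicit.
Unset Printing Implicit Defensive.

Import Order.TTheory GRing.Theory Num.Theory.
Local Open Scope classical_set_scope.
Local Open Scope ring_scope.

Definition nonarch_abs (R : realType) (F : fieldType) (v : F -> R) : Prop :=
  [/\ forall x, 0 <= v x,
      forall x, v x = 0 <-> x = 0,
      {morph v : x y / x * y}
    & forall x y, v (x + y) <= Num.max (v x) (v y)].

Definition abs_complete (R : realType) (F : fieldType) (v : F -> R) : Prop :=
  forall u : nat -> F,
    (forall eps, 0 < eps -> exists N, forall m n,
       (N <= m)%N -> (N <= n)%N -> v (u m - u n) < eps) ->
    exists l, forall eps, 0 < eps -> exists N, forall n,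
      (N <= n)%N -> v (u n - l) < eps.

(* The absolute value c ^ ord_p on the rationals; c = 1/p is the usual one. *)
Definition padic_abs (R : realType) (c : R) (p : nat) (x : rat) : R :=
  if x == 0 then 0
  else c ^ ((logn p `|numq x|%N)%:Z - (logn p `|denq x|%N)%:Z).

(* Q_p as the completion of the rationals: a complete valued field in which
   they are dense, inducing the p-adic absolute value on them. Note that
   [extends] forces characteristic 0, so ratr is the embedding. *)
Record is_padic_field (R : realType) (c : R) (p : nat)
    (F : fieldType) (v : F -> R) : Prop := {
  padic_nonarch : nonarch_abs v;
  padic_extends : forall x : rat, v (ratr x) = padic_abs c p x;
  padic_dense : forall x eps, 0 < eps -> exists r : rat, v (x - ratr r) < eps;
  padic_complete : abs_complete v }.

(* F((T)), as sequences of coefficients indexed by int. *)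
Definition laurent_series (F : fieldType) : set (int -> F) :=
  [set a | exists N : int, forall n, n < N -> a n = 0].

(* For Laurent series a and b only finitely many terms are nonzero. *)
Definition laurent_mul (F : fieldType) (a b : int -> F) (n : int) : F :=
  \sum_(i \in [set: int]) (a i * b (n - i)).

(* The normalization of the absolute value (c = 1/p, 1/q, ...) is left free:
   c is any real number in ]0, 1[. *)
Variant local_field (R : realType) (K : fieldType) (v : K -> R) : Prop :=
| PadicLocalField (p : nat) (c : R) (Qp : fieldType) (vp : Qp -> R)
    (L : fieldExtType Qp) (f : {rmorphism L -> K}) of
    prime p & 0 < c < 1 & is_padic_field c p vp & bijective f &
    nonarch_abs v & forall a : Qp, v (f a%:A) = vp a
| LaurentLocalField (Fq : finFieldType) (c : R) (f : K -> int -> Fq) of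
    0 < c < 1 & set_bij [set: K] (@laurent_series Fq) f &
    (forall x y n, f (x + y) n = f x n + f y n) &
    (forall x y, f (x * y) = laurent_mul (f x) (f y)) &
    v 0 = 0 &
    (forall x n, (forall m, m < n -> f x m = 0) -> f x n != 0 -> v x = c ^ n).

Definition integers (R : realType) (K : fieldType) (v : K -> R) : {pred K} :=
  [pred x | v x <= 1].

Definition invertible_integer (R : realType) (K : fieldType) (v : K -> R)
    (x : K) : Prop :=
  x \in integers v /\ exists2 y, y \in integers v & x * y = 1.

Definition superattracting_integral (R : realType) (K : fieldType)
    (v : K -> R) (e : nat) (phi : {fraction {poly K}}) : Prop :=
  exists f1 f2 : {poly K},
    [/\ f1 \is monic /\ f1 \is a polyOver (integers v),
        f2 \is monic /\ f2 \is a polyOver (integers v),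
        (size f1).-1 = ((size f2).-1 + e)%N
      & phi = FracField.tofrac f1 / FracField.tofrac f2].

(* phi(x) = y at a finite point x of an extension L of K: phi has a
   representative g / h whose denominator does not vanish at x. *)
Definition ratfun_value (K L : fieldType) (iota : {rmorphism K -> L})
    (phi : {fraction {poly K}}) (x y : L) : Prop :=
  exists g h : {poly K},
    [/\ phi = FracField.tofrac g / FracField.tofrac h,
        (map_poly iota h).[x] != 0
      & y = (map_poly iota g).[x] / (map_poly iota h).[x]].

(* phi^n(x) = y through finite points only. When phi fixes infinity, as a
   superattracting integral map does, no other orbit reaches a finite y. *)
Fixpoint iter_value (K L : fieldType) (iota : {rmorphism K -> L})
    (phi : {fraction {poly K}}) (n : nat) (x y : L) : Prop :=
  if n is m.+1 then
    exists2 z, ratfun_value iota phi x z & iter_value iota phi m z y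
  else x = y.

Section GeneratedSubfield.
Variables (L : fieldType) (A : set L).

(* Boolean, through asbool, so that the subtype below inherits a field structure. *)
Definition generated_pred : L -> bool := fun x =>
  `[< smallest (fun S : set L => divring_closed [pred x in S]) A x >].

Lemma generated_closed : divring_closed generated_pred.
Proof.
have memP (S : set L) z : (z \in [pred x in S]) = (z \in S) by [].
split=> [|x y|x y].
- apply/asboolP => S [[S1 _ _] _].
  by move: S1; rewrite memP => /set_mem.
- move=> /asboolP Hx /asboolP Hy; apply/asboolP => S HS.
  have [[_ Sb _] _] := HS; apply/set_mem.
  by rewrite -memP; apply: Sb; rewrite memP; apply/mem_set; [apply: Hx|apply: Hy].
- move=> /asboolP Hx /asboolP Hy; apply/asboolP => S HS.
  have [[_ _ Sd] _] := HS; apply/set_mem.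
  by rewrite -memP; apply: Sd; rewrite memP; apply/mem_set; [apply: Hx|apply: Hy].
Qed.

HB.instance Definition _ :=
  GRing.isDivringClosed.Build L generated_pred generated_closed.

Record generated_field : Type := GeneratedField {
  generated_val :> L;
  generated_valP : generated_pred generated_val }.

HB.instance Definition _ := [isSub for generated_val].
HB.instance Definition _ := [Choice of generated_field by <:].
HB.instance Definition _ :=
  [SubChoice_isSubIntegralDomain of generated_field by <:].
HB.instance Definition _ :=
  [SubIntegralDomain_isSubField of generated_field by <:].

Lemma sub_generated x : A x -> generated_pred x.
Proof. by move=> Ax; apply/asboolP; apply: sub_gen_smallest. Qed.

End GeneratedSubfield.

Definition algebraic_closure (K : fieldType) (Kbar : closedFieldType)
    (iota : {rmorphism K -> Kbar}) : Prop :=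
  forall z, algebraicOver iota z.

Definition K_infty_generators (K L : fieldType) (iota : {rmorphism K -> L})
    (phi : {fraction {poly K}}) (alpha : K) : set L :=
  range iota `|` [set x | exists n, iter_value iota phi n x (iota alpha)].

Definition K_infty (K L : fieldType) (iota : {rmorphism K -> L})
    (phi : {fraction {poly K}}) (alpha : K) : fieldType :=
  generated_field (K_infty_generators iota phi alpha).

Definition K_infty_incl (K L : fieldType) (iota : {rmorphism K -> L})
    (phi : {fraction {poly K}}) (alpha : K) (c : K) :
    K_infty iota phi alpha :=
  GeneratedField (sub_generated
    (or_introl (imageT iota c) : K_infty_generators iota phi alpha (iota c))).

(* Gal(E / K), where j is the inclusion of K into E. *)
Definition galois_group (K E : fieldType) (j : K -> E) :
    set {rmorphism E -> E} :=
  [set s : {rmorphism E -> E} | bijective s /\ forall c, s (j c) = j c].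

Definition abelian_automorphisms (E : fieldType)
    (G : set {rmorphism E -> E}) : Prop :=
  forall s t, G s -> G t -> s \o t =1 t \o s.

(* Main.v *)
Require Import Defs.
From HB Require Import structures.
From mathcomp Require Import all_boot all_order all_algebra all_field.
From mathcomp Require Import all_classical all_reals.
From mathcomp Require Import cyclic ring.

Set Implicit Arguments.
Unset Strict Implicit.
Unset Printing Implicit Defensive.

Import Order.TTheory GRing.Theory Num.Theory.
Local Open Scope ring_scope.

(** Write |.| for v, E for the algebraic closure and G for the group of
    automorphisms of E over K. If the Galois group of K_infty is abelian, any
    two elements of G commute on the iterated preimages of alpha
    ([abelian_fixes_commute]); the contradiction comes from tame ramification,
    seen on the leading terms of the preimages.

    Let O be the integral closure in E of the integers of K. It is a valuation
    ring by completeness ([integral_closure_val], from Hensel's lemma in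
    the form [irreducible_coef_le]), and it is stable under G by construction.
    Let m be its maximal ideal. If z is not in O, one root x of f1 - z f2 is
    not in O, and then x ^ e = z up to a factor in 1 + m ([large_preimage]).
    Hence for every n some preimage x under phi ^ n satisfies x ^ N = alpha up
    to 1 + m, where N = e ^ n ([large_iterated_preimage]).

    Let q > 1 be a power of the residue characteristic p such that z ^ q = z
    mod m for all integers z of K. As p does not divide e, the solutions of
    u ^ N = 1 mod m are, mod m, the powers of a primitive N-th root of unity,
    and some s in G acts on them as u |-> u ^ q
    ([exists_frobenius_on_roots]). Put y = x ^ q / s x. For t in G, the
    quotient u = t x / x satisfies u ^ N = 1 mod m, and since t and s commute
    at x, t y / y = u ^ q / s u is in 1 + m. So all the conjugates of y agree
    with y up to 1 + m, and then y ^ (p ^ a) is a unit multiple of some c in K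
    for some a ([tame_descent]): c is a coefficient of the minimal polynomial
    of y. Since s x / x is a unit, y is a unit times x ^ (q - 1), and
    |c| ^ N = |alpha| ^ (p ^ a (q - 1)) ([commuting_value]). The values of K
    lie in a discrete group and N is prime to p, so N = e ^ n divides a nonzero
    integer that does not depend on n, which is absurd for large n.

    Completeness, discreteness of the values and finiteness of the residue field
    are properties of B, which is Qp in the p-adic case and K itself for Laurent
    series; O is the integral closure of the integers of B, and the properties
    of K used above follow from those of B because the degrees over B of the
    elements of K are bounded ([finite_over_local]).

    Automorphisms of E are produced by Zorn's lemma
    ([exists_conjugating_endomorphism]); G is the set of endomorphisms s of E
    with [fixes iota s], which are bijective ([fixes_inverse]). *)

(** * Extension of embeddings and conjugates *)

Lemma algebraic_irreducible_root (F : fieldType) (E : fieldType)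
    (iota : {rmorphism F -> E}) (x : E) :
  algebraicOver iota x ->
  exists f : {poly F},
    [/\ f \is monic, irreducible_poly f & root (map_poly iota f) x].
Proof.
move=> [p0 p0_neq0 p0x].
pose P n := `[< exists p : {poly F}, [/\ size p = n, p != 0 & root (map_poly iota p) x] >].
have exP : exists n, P n by exists (size p0); apply/asboolP; exists p0.
case: (ex_minnP exP) => n /asboolP[p [sz_p p_neq0 px]] min_n.
have min_p q : q != 0 -> root (map_poly iota q) x -> (size p <= size q)%N.
  by move=> q_neq0 qx; rewrite sz_p; apply: min_n; apply/asboolP; exists q.
have lp : lead_coef p != 0 by rewrite lead_coef_eq0.
pose f := (lead_coef p)^-1 *: p.
have fp : f %= p by rewrite eqp_scale ?invr_eq0.
exists f; split.
- by rewrite monicE lead_coefZ mulVf.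
- have szf : (1 < size f)%N.
    rewrite (eqp_size fp) ltnNge; apply/negP => /size1_polyC p_const.
    move: px p_neq0; rewrite p_const map_polyC rootC fmorph_eq0 polyC_eq0.
    by move=> ->.
  split=> // q szq q_dvd_f.
  have f_neq0 : f != 0 by rewrite -size_poly_gt0 ltnW.
  have /dvdpP[g fE] := q_dvd_f.
  have [gq0 q_neq0] : g != 0 /\ q != 0.
    by apply/andP; rewrite -negb_or -mulf_eq0 -fE.
  have : root (map_poly iota f) x.
    by rewrite map_polyZ rootZ ?px // fmorph_eq0 invr_eq0.
  rewrite -dvdp_size_eqp //.
  rewrite fE rmorphM rootM => /orP[gx|qx].
  + have := min_p _ gq0 gx; rewrite -(eqp_size fp) fE size_mul //.
    move: szq gq0 q_neq0; rewrite -!size_poly_gt0.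
    case: (size g) => [|a]; case: (size q) => [|[|b]] // _ _ _.
    by rewrite addnS /= addnS ltnNge leq_addr.
  + rewrite eqn_leq -fE dvdp_leq //=.
    by rewrite (eqp_size fp) min_p.
- by rewrite map_polyZ rootZ ?px // fmorph_eq0 invr_eq0.
Qed.

Lemma irreducible_root_dvd (F E : fieldType) (iota : {rmorphism F -> E})
    (f g : {poly F}) (x : E) :
  irreducible_poly f -> root (map_poly iota f) x ->
  root (map_poly iota g) x -> f %| g.
Proof.
move=> irr_f fx gx.
have [//|/negbTE ndvd] := boolP (f %| g).
have cop : coprimep f g by rewrite irreducible_poly_coprime // ndvd.
move: cop; rewrite -(coprimep_map iota) => cop.
by have := coprimep_root cop fx; rewrite (rootP gx) eqxx.
Qed.

(** One step of the extension of embeddings: T is a subfield of E given through pi1,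
    and pi2 is an embedding of it. The image of z is a root of the transported
    minimal polynomial. *)
Lemma extend_embedding_at (T : comNzRingType) (E : closedFieldType)
    (pi1 pi2 : {rmorphism T -> E}) (z : E) :
  (forall t : T, t != 0 -> exists t', t * t' = 1) ->
  (exists2 p : {poly T}, p \is monic & root (map_poly pi1 p) z) ->
  exists w, forall p : {poly T}, root (map_poly pi1 p) z ->
    root (map_poly pi2 p) w.
Proof.
move=> Tinv [p0 p0mon p0z].
have pi1_neq0 t : t != 0 -> pi1 t != 0.
  move=> /Tinv[t' tt']; apply/negP => /eqP t0.
  by have := oner_neq0 E; rewrite -(rmorph1 pi1) -tt' rmorphM t0 mul0r eqxx.
pose P n := `[< exists p : {poly T},
  [/\ size p = n, p \is monic & root (map_poly pi1 p) z] >].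
have exP : exists n, P n by exists (size p0); apply/asboolP; exists p0.
case: (ex_minnP exP) => n /asboolP[m [sz_m m_mon mz]] min_n.
have min_m q : q \is monic -> root (map_poly pi1 q) z -> (size m <= size q)%N.
  by move=> qmon qz; rewrite sz_m; apply: min_n; apply/asboolP; exists q.
have size_pi2m : size (map_poly pi2 m) = size m.
  by rewrite size_map_poly_id0 // (monicP m_mon) rmorph1 oner_neq0.
have szm : size m != 1%N.
  apply/eqP => /eqP/size_poly1P[c c_neq0 mE].
  by move: mz; rewrite mE map_polyC rootC (negbTE (pi1_neq0 _ c_neq0)).
have [w mw] : exists w, root (map_poly pi2 m) w.
  by apply: closed_rootP; rewrite size_pi2m.
exists w => p pz.
have eqp := Pdiv.RingMonic.rdivp_eq m_mon p.
set r := Pdiv.Ring.rmodp p m in eqp.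
have rz : root (map_poly pi1 r) z.
  move: pz; rewrite eqp rmorphD rmorphM /= /root hornerD hornerM.
  by rewrite (rootP mz) mulr0 add0r.
suff r0 : r = 0.
  by rewrite eqp r0 addr0 rmorphM /= /root hornerM (rootP mw) mulr0.
apply/eqP; apply: contraT => r_neq0.
have [c rc] : exists c, lead_coef r * c = 1 by apply: Tinv; rewrite lead_coef_eq0.
have szr : (size r < size m)%N by rewrite Pdiv.Ring.ltn_rmodpN0 ?monic_neq0.
have r_mon : c *: r \is monic.
  rewrite monicE /lead_coef.
  have -> : size (c *: r) = size r.
    apply/eqP; rewrite eqn_leq size_scale_leq /=.
    by have := size_scale_leq (lead_coef r) (c *: r); rewrite scalerA rc scale1r.
  by rewrite coefZ mulrC -/(lead_coef r) rc.
have := min_m _ r_mon; rewrite map_polyZ /root hornerZ (rootP rz) mulr0 eqxx.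
by move=> /(_ isT)/leq_trans/(_ (size_scale_leq _ _)); rewrite leqNgt szr.
Qed.

Section PartialEmbeddings.
Variables (F : fieldType) (E : closedFieldType) (iota : {rmorphism F -> E}).
Hypothesis iota_alg : algebraic_closure iota.

(** Graphs of F-embeddings into E of rings between F and E. *)
Definition partial_embedding (G : set (E * E)) : Prop :=
  [/\ subring_closed [pred u in G], forall c, G (iota c, iota c)
    & forall b, G (0, b) -> b = 0].

Section Extension.
Variables (T : comNzRingType) (pi1 pi2 : {rmorphism T -> E}).
Hypothesis pi1_eq0 : forall t, pi1 t = 0 -> t = 0.
Hypothesis pi_const : forall c, exists t, pi1 t = iota c /\ pi2 t = iota c.

Let const_poly (p : {poly F}) : exists P : {poly T}, map_poly pi1 P = map_poly iota p.
Proof.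
pose t c := sval (cid (pi_const c)).
have tE c : pi1 (t c) = iota c by case: (svalP (cid (pi_const c))).
exists (\poly_(i < size p) t p`_i); apply/polyP => i.
rewrite !coef_map coef_poly /=; case: ltnP => [_|szp]; first exact: tE.
by rewrite (nth_default _ szp) !rmorph0.
Qed.

(** An inverse of an element a algebraic over F is a polynomial in a, so every ring
    between F and E is a field. *)
Let ring_inv (t : T) : t != 0 -> exists t', t * t' = 1.
Proof.
move=> t_neq0; have [f [_ f_irr ft]] := algebraic_irreducible_root (iota_alg (pi1 t)).
have t1_neq0 : pi1 t != 0 by apply: contra_neq t_neq0; apply: pi1_eq0.
have f0 : f`_0 != 0.
  rewrite -horner_coef0; apply/negP => f_root0.
  have f0r : root (map_poly iota f) (iota 0) by rewrite fmorph_root.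
  have X0 : root (map_poly iota 'X) (iota 0) by rewrite fmorph_root rootX.
  have := irreducible_root_dvd f_irr f0r X0.
  move=> /dvdpP[g gE].
  have Xt : root (map_poly iota 'X) (pi1 t) by rewrite gE rmorphM rootM ft orbT.
  by move: Xt; rewrite map_polyX rootX (negbTE t1_neq0).
have [k fE] : exists k : {poly F}, f = k * 'X + (f`_0)%:P.
  have /dvdpP[k kE] : 'X %| f - (f`_0)%:P.
    by rewrite -['X]subr0 -polyC0 dvdp_XsubCl /root !hornerE horner_coef0 subrr.
  by exists k; rewrite -kE subrK.
have [P PE] := const_poly (- (f`_0)^-1 *: k).
exists P.[t]; apply/eqP; rewrite -subr_eq0; apply/eqP/pi1_eq0.
have kt : (map_poly iota k).[pi1 t] * pi1 t = - iota f`_0.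
  move: ft; rewrite {1}fE /root rmorphD rmorphM /= map_polyX map_polyC.
  by rewrite hornerD hornerM hornerX hornerC addr_eq0 => /eqP.
have c_inv : iota (- (f`_0)^-1) * - iota f`_0 = 1.
  by rewrite rmorphN mulrNN -rmorphM mulVf ?rmorph1.
rewrite rmorphB rmorphM rmorph1 -horner_map PE map_polyZ hornerZ.
by rewrite mulrC -mulrA kt c_inv subrr.
Qed.

Lemma extend_embedding (z : E) :
  exists G, [/\ partial_embedding G, forall t, G (pi1 t, pi2 t)
    & exists w, G (z, w)].
Proof.
have [f [f_mon _ fz]] := algebraic_irreducible_root (iota_alg z).
have [p p_mon pz] : exists2 p : {poly T}, p \is monic & root (map_poly pi1 p) z.
  have [P PE] := const_poly f.
  exists P; last by rewrite PE.
  have szP : size (map_poly pi1 P) = size P.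
    have [->|P0] := eqVneq P 0; first by rewrite raddf0 !size_poly0.
    have : pi1 (lead_coef P) != 0.
      by apply: contra_neq P0 => /pi1_eq0 /eqP; rewrite lead_coef_eq0 => /eqP.
    by move=> /size_map_poly_id0 ->.
  have := f_mon; rewrite -(map_monic iota) -PE monicE /lead_coef szP coef_map => /eqP P1.
  rewrite monicE -subr_eq0; apply/eqP/pi1_eq0.
  by rewrite rmorphB rmorph1 P1 subrr.
have [w zw] := extend_embedding_at pi2 ring_inv (ex_intro2 _ _ p p_mon pz).
exists [set u : E * E | exists P : {poly T},
  u = ((map_poly pi1 P).[z], (map_poly pi2 P).[w])]%classic; split.
- split.
  + split=> [|_ _ /set_mem[P ->] /set_mem[Q ->]
             |_ _ /set_mem[P ->] /set_mem[Q ->]]; apply/mem_set.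
    * by exists 1; rewrite !rmorph1 !hornerC.
    * by exists (P - Q); rewrite !rmorphB /= !hornerE.
    * by exists (P * Q); rewrite !rmorphM /= !hornerM.
  + move=> c; have [t [t1 t2]] := pi_const c.
    by exists t%:P; rewrite !map_polyC !hornerC /= t1 t2.
  + by move=> b [P [/esym P1 ->]]; apply/eqP/zw/rootP.
- by move=> t; exists t%:P; rewrite !map_polyC !hornerC.
- by exists w, 'X; rewrite !map_polyX !hornerX.
Qed.

End Extension.

(** A graph G is itself a subring of E * E, with its two projections to E. *)
Section GraphRing.
Variables (G : set (E * E)) (embG : partial_embedding G).

Definition graph_pred : {pred E * E} := [pred u in G].

Fact graph_pred_subring : subring_closed graph_pred.
Proof. by case: embG. Qed.

HB.instance Definition _ :=
  GRing.isSubringClosed.Build (E * E)%type graph_pred graph_pred_subring.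

Record graph_ring : Type := GraphRing {
  graph_val :> E * E;
  graph_valP : graph_val \in graph_pred }.

HB.instance Definition _ := [isSub for graph_val].
HB.instance Definition _ := [Choice of graph_ring by <:].
HB.instance Definition _ := [SubChoice_isSubComNzRing of graph_ring by <:].

Lemma extend_partial_embedding (z : E) :
  exists G', [/\ partial_embedding G', (G `<=` G')%classic
    & exists w, G' (z, w)].
Proof.
pose T : comNzRingType := graph_ring.
pose val_rm : {rmorphism T -> (E * E)%type} := \val.
have graphP u : G u -> exists t : T, \val t = u.
  by move=> Gu; exists (GraphRing (mem_set Gu : u \in graph_pred)).
have [||G' [embG' GG' zG']] :=
    @extend_embedding T (fst \o val_rm) (snd \o val_rm) _ _ z.
- move=> t /= t1; have := set_mem (graph_valP t).
  rewrite (surjective_pairing (graph_val t)) t1.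
  case: embG => _ _ G0 /G0 t2.
  by apply/val_inj; rewrite [LHS]surjective_pairing; congr (_, _).
- move=> c; have /graphP[t tE] : G (iota c, iota c) by case: embG.
  by exists t; rewrite /= tE.
exists G'; split=> // u /graphP[t <-].
by have := GG' t; rewrite /= -surjective_pairing.
Qed.

End GraphRing.

Lemma partial_embedding_bigcup (C : set (set (E * E))) :
  (exists G, C G) -> (forall G, C G -> partial_embedding G) ->
  total_on C subset -> partial_embedding (\bigcup_(G in C) G)%classic.
Proof.
move=> [G0 CG0] embC totC; split.
- have common u v : (\bigcup_(G in C) G)%classic u ->
    (\bigcup_(G in C) G)%classic v -> exists G, [/\ C G, G u & G v].
    move=> [G CG Gu] [H CH Hv]; have [GH|HG] := totC _ _ CG CH.
      by exists H; split=> //; apply: GH.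
    by exists G; split=> //; apply: HG.
  split=> [|u v /set_mem u_in /set_mem v_in|u v /set_mem u_in /set_mem v_in];
      apply/mem_set.
  + by exists G0 => //; have [[/set_mem]] := embC _ CG0.
  + have [G [CG Gu Gv]] := common _ _ u_in v_in; exists G => //.
    by have [[_ subG _] _ _] := embC _ CG; apply/set_mem/subG; apply/mem_set.
  + have [G [CG Gu Gv]] := common _ _ u_in v_in; exists G => //.
    by have [[_ _ mulG] _ _] := embC _ CG; apply/set_mem/mulG; apply/mem_set.
- by move=> c; exists G0 => //; have [] := embC _ CG0.
- by move=> b [G CG G0b]; have [_ _] := embC _ CG; apply.
Qed.

Lemma extend_to_endomorphism (G : set (E * E)) :
  partial_embedding G ->
  exists s : {rmorphism E -> E},
    (forall c, s (iota c) = iota c) /\ forall u, G u -> s u.1 = u.2.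
Proof.
move=> embG.
(* The union of the empty chain is empty, hence the first alternative. *)
pose P (H : set (E * E)) := H = set0 \/ partial_embedding H /\ (G `<=` H)%classic.
have [H [PH maxH]] : exists H, P H /\ forall H', (H `<` H')%classic -> ~ P H'.
  apply: Zorn_bigcup => C CP totC.
  pose C' := (C `\ set0)%classic.
  have embC' H : C' H -> partial_embedding H /\ (G `<=` H)%classic.
    by move=> [CH H0]; case: (CP _ CH).
  have [[H C'H]|noC'] := pselect (exists H, C' H); last first.
    left; apply/seteqP; split=> // u [H CH Hu]; case: noC'; exists H; split=> //.
    by move=> H0; rewrite H0 in Hu.
  right; have -> : (\bigcup_(X in C) X = \bigcup_(X in C') X)%classic.
    apply/seteqP; split=> u [X CX Xu]; exists X => //; last by case: CX.
    by split=> // X0; rewrite X0 in Xu.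
  split.
    apply: partial_embedding_bigcup; first by exists H.
      by move=> X /embC'[].
    by move=> X Y [CX _] [CY _]; apply: totC.
  by move=> u Gu; exists H => //; have [_] := embC' _ C'H; apply.
have [embH GH] : partial_embedding H /\ (G `<=` H)%classic.
  case: PH => // H0; exfalso.
  have G1 : G 1 by have [[/set_mem]] := embG.
  apply: (maxH G); last by right; split=> // u.
  by rewrite properEneq H0; split; [apply/eqP => G0; rewrite -G0 in G1|].
have domH z : exists w, H (z, w).
  have [H' [embH' HH' [w H'zw]]] := extend_partial_embedding embH z.
  exists w; suff -> : H = H' by [].
  apply/eqP; apply: contraT => HneH'; exfalso; apply: (maxH H').
    by rewrite properEneq; split.
  by right; split=> // u Gu; apply/HH'/GH.
have [[H1 Hsub Hmul] HF H0] := embH.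
have funH z w w' : H (z, w) -> H (z, w') -> w = w'.
  move=> /mem_set Hw /mem_set Hw'; apply/eqP; rewrite -subr_eq0; apply/eqP/H0.
  by rewrite -[X in H (X, _)](subrr z); apply/set_mem/(Hsub _ _ Hw Hw').
pose s z := sval (cid (domH z)).
have Hs z : H (z, s z) by apply: (svalP (cid (domH z))).
have sB : zmod_morphism s.
  by move=> x y; apply: funH (Hs _) _; apply/set_mem/(Hsub (x, _) (y, _)); apply/mem_set.
have sM : monoid_morphism s.
  split; first by apply: funH (Hs _) _; apply/set_mem.
  by move=> x y; apply: funH (Hs _) _; apply/set_mem/(Hmul (x, _) (y, _)); apply/mem_set.
pose sA := GRing.isZmodMorphism.Build _ _ _ sB.
pose sMM := GRing.isMonoidMorphism.Build _ _ _ sM.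
pose sR : {rmorphism E -> E} := HB.pack s sA sMM.
exists sR; split=> [c|[x y] /GH Hxy]; first exact: funH (Hs _) (HF c).
exact: funH (Hs _) Hxy.
Qed.

Lemma exists_conjugating_endomorphism (f : {poly F}) (x y : E) :
  irreducible_poly f -> root (map_poly iota f) x -> root (map_poly iota f) y ->
  exists s : {rmorphism E -> E}, (forall c, s (iota c) = iota c) /\ s x = y.
Proof.
move=> f_irr fx fy.
have pres p : root (map_poly iota p) x -> root (map_poly iota p) y.
  move=> /(irreducible_root_dvd f_irr fx)/dvdpP[g ->].
  by rewrite rmorphM rootM fy orbT.
pose G := [set u : E * E | exists p : {poly F},
  u = ((map_poly iota p).[x], (map_poly iota p).[y])]%classic.
have [|s [s_iota sG]] := @extend_to_endomorphism G.
  split.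
  + split=> [|_ _ /set_mem[P ->] /set_mem[Q ->]
             |_ _ /set_mem[P ->] /set_mem[Q ->]]; apply/mem_set.
    * by exists 1; rewrite !rmorph1 !hornerC.
    * by exists (P - Q); rewrite !rmorphB /= !hornerE.
    * by exists (P * Q); rewrite !rmorphM /= !hornerM.
  + by move=> c; exists c%:P; rewrite !map_polyC !hornerC.
  + by move=> b [P [/esym P1 ->]]; apply/eqP/pres/rootP.
exists s; split=> //; apply: (sG (x, y)).
by exists 'X; rewrite !map_polyX !hornerX.
Qed.

End PartialEmbeddings.

Section Conjugates.
Variables (F : fieldType) (E : closedFieldType) (iota : {rmorphism F -> E}).
Hypothesis iota_alg : algebraic_closure iota.

Definition fixes (s : {rmorphism E -> E}) : Prop := forall c, s (iota c) = iota c.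

Lemma fixes_root (s : {rmorphism E -> E}) (p : {poly F}) (x : E) :
  fixes s -> root (map_poly iota p) x -> root (map_poly iota p) (s x).
Proof.
move=> s_fix px; have := rmorph_root s px.
rewrite -map_poly_comp; congr (root _ _).
by apply: eq_map_poly => c /=; apply: s_fix.
Qed.

Lemma fixes_horner (s : {rmorphism E -> E}) (p : {poly F}) (x : E) :
  fixes s -> s (map_poly iota p).[x] = (map_poly iota p).[s x].
Proof.
move=> s_fix; rewrite -horner_map -map_poly_comp.
by congr horner; apply: eq_map_poly => c /=; apply: s_fix.
Qed.

Lemma min_poly_conjugates (x : E) :
  exists (f : {poly F}) (rs : seq E),
    [/\ f \is monic, irreducible_poly f,
        map_poly iota f = \prod_(z <- rs) ('X - z%:P), x \in rs
      & forall z, z \in rs -> exists s, fixes s /\ s x = z].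
Proof.
have [f [f_mon f_irr fx]] := algebraic_irreducible_root (iota_alg x).
have [rs frs] := closed_field_poly_normal (map_poly iota f).
have f1 : lead_coef (map_poly iota f) = 1 by apply/monicP; rewrite map_monic.
rewrite f1 scale1r in frs.
exists f, rs; split=> // [|z zrs].
  by rewrite -root_prod_XsubC -frs.
apply: exists_conjugating_endomorphism f_irr fx _ => //.
by rewrite frs root_prod_XsubC.
Qed.

(** s permutes the finite set of conjugates of x. *)
Lemma fixes_periodic (s : {rmorphism E -> E}) (x : E) :
  fixes s -> exists2 n, (0 < n)%N & iter n s x = x.
Proof.
move=> s_fix; have [f [rs [_ _ frs xrs _]]] := min_poly_conjugates x.
have orbit_rs n : iter n s x \in rs.
  elim: n => //= n; rewrite -!root_prod_XsubC -frs.
  exact: fixes_root.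
have : looping s x (size rs).
  apply: contraT; rewrite -looping_uniq => uniq_orbit.
  have := uniq_leq_size uniq_orbit (s2 := rs).
  rewrite size_traject ltnn; apply.
  by move=> _ /trajectP[i _ ->].
move=> /trajectP[i i_lt eq_iter].
exists (size rs - i)%N; first by rewrite subn_gt0.
have iter_inj k : injective (iter k s).
  by elim: k => // k IHk y z /= /fmorph_inj /IHk.
by apply: (@iter_inj i); rewrite -iterD subnKC // ltnW.
Qed.

Lemma fixes_inverse (s : {rmorphism E -> E}) :
  fixes s -> exists s' : {rmorphism E -> E},
    [/\ fixes s', cancel s s' & cancel s' s].
Proof.
move=> s_fix.
have s_surj y : exists x, s x = y.
  have [[//|n] _ <-] := fixes_periodic y s_fix.
  by exists (iter n s y).
pose g y := sval (cid (s_surj y)).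
have gK : cancel g s by move=> y; apply: (svalP (cid (s_surj y))).
have sK : cancel s g by move=> x; apply: (fmorph_inj s); rewrite gK.
pose gA := GRing.isZmodMorphism.Build _ _ _ (can2_zmod_morphism sK gK).
pose gM := GRing.isMonoidMorphism.Build _ _ _ (can2_monoid_morphism sK gK).
pose gR : {rmorphism E -> E} := HB.pack g gA gM.
exists gR; split=> // c.
by apply: (fmorph_inj s); rewrite s_fix; apply: gK.
Qed.

End Conjugates.

(** * Valuation rings *)

Record valuation_subring (E : fieldType) : Type := ValuationSubring {
  valuation_pred :> {pred E};
  valuation_subring_closed : subring_closed valuation_pred;
  valuation_total : forall x, x \in valuation_pred \/ x^-1 \in valuation_pred }.

Section ValuationRing.
Variables (E : fieldType) (O : valuation_subring E).

HB.instance Definition _ := GRing.isSubringClosed.Build E (valuation_pred O)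
  (@valuation_subring_closed E O).

Let O_val : forall x, x \in O \/ x^-1 \in O := @valuation_total E O.

Definition nonunits : {pred E} := [pred x | (x == 0) || (x^-1 \notin O)].

Lemma nonunits0 : 0 \in nonunits.
Proof. by rewrite inE eqxx. Qed.

Lemma nonunitsP x : x != 0 -> (x \in nonunits) = (x^-1 \notin O).
Proof. by move=> x0; rewrite inE (negbTE x0). Qed.

Lemma nonunits_sub x : x \in nonunits -> x \in O.
Proof.
move=> /orP[/eqP->|x_inv]; first exact: rpred0.
by case: (O_val x) => //; rewrite (negbTE x_inv).
Qed.

Lemma notin_val x : x \notin O -> x != 0 /\ x^-1 \in nonunits.
Proof.
move=> xO; have x0 : x != 0 by apply: contraNneq xO => ->; apply: rpred0.
by rewrite nonunitsP ?invr_eq0 // invrK.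
Qed.

Lemma unit_val x : x \notin nonunits -> x != 0 /\ x^-1 \in O.
Proof. by rewrite inE negb_or negbK => /andP. Qed.

Lemma nonunitsM x a : a \in O -> x \in nonunits -> a * x \in nonunits.
Proof.
move=> aO xm; have [->|ax0] := eqVneq (a * x) 0; first exact: nonunits0.
have /andP[a0 x0] : (a != 0) && (x != 0) by rewrite -negb_or -mulf_eq0.
move: xm; rewrite !nonunitsP //; apply: contra => axO.
have -> : x^-1 = a * (a * x)^-1 by rewrite invfM mulrA divff ?mul1r.
by rewrite rpredM.
Qed.

Lemma nonunitsMr x a : a \in O -> x \in nonunits -> x * a \in nonunits.
Proof. by move=> aO xm; rewrite mulrC nonunitsM. Qed.

Lemma nonunits_zmod : zmod_closed nonunits.
Proof.
split=> [|x y xm ym]; first exact: nonunits0.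
have [->|x0] := eqVneq x 0; first by rewrite sub0r -mulN1r nonunitsM ?rpredN1.
have [->|y0] := eqVneq y 0; first by rewrite subr0.
case: (O_val (x / y)) => [xyO|]; last rewrite invf_div => yxO.
  have -> : x - y = (x / y - 1) * y by rewrite mulrBl divfK // mul1r.
  by rewrite nonunitsM ?rpredB ?rpred1.
have -> : x - y = (1 - y / x) * x by rewrite mulrBl divfK // mul1r.
by rewrite nonunitsM ?rpredB ?rpred1.
Qed.

HB.instance Definition _ := GRing.isZmodClosed.Build E nonunits nonunits_zmod.

Lemma nonunits1 : 1 \notin nonunits.
Proof. by rewrite nonunitsP ?oner_neq0 // invr1 rpred1. Qed.

Lemma nonunits_prime x y :
  x \in O -> y \in O -> x * y \in nonunits -> x \in nonunits \/ y \in nonunits.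
Proof.
move=> xO yO; have [|/unit_val[x0 xi]] := boolP (x \in nonunits); first by left.
have [|/unit_val[y0 yi]] := boolP (y \in nonunits); first by right.
by rewrite nonunitsP ?mulf_neq0 // invfM rpredM.
Qed.

Lemma nonunits_exp x n : x \in O -> x ^+ n \in nonunits -> x \in nonunits.
Proof.
move=> xO; elim: n => [|n IHn]; first by rewrite expr0 (negbTE nonunits1).
by rewrite exprS => /nonunits_prime[]//; rewrite rpredX.
Qed.

Lemma nonunits_prod (I : eqType) (rs : seq I) (g : I -> E) :
  (forall i, i \in rs -> g i \in O) -> \prod_(i <- rs) g i \in nonunits ->
  exists2 i, i \in rs & g i \in nonunits.
Proof.
elim: rs => [|i rs IHrs] gO; first by rewrite big_nil (negbTE nonunits1).
have rsO k : k \in rs -> g k \in O by move=> krs; rewrite gO // inE krs orbT.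
rewrite big_cons => /nonunits_prime[||gi|].
- by rewrite gO ?mem_head.
- by rewrite big_seq rpred_prod.
- by exists i; rewrite ?mem_head.
- by move=> /(IHrs rsO)[k krs gk]; exists k => //; rewrite inE krs orbT.
Qed.

(** Congruence modulo the maximal ideal. *)
Definition congr x y := x - y \in nonunits.

Lemma congr_refl x : congr x x. Proof. by rewrite /congr subrr nonunits0. Qed.
Lemma congr_sym x y : congr x y -> congr y x.
Proof. by rewrite /congr -[y - x]opprB rpredN. Qed.
Lemma congr_trans y x z : congr x y -> congr y z -> congr x z.
Proof. by rewrite /congr => xy /(rpredD xy); rewrite addrA subrK. Qed.
Lemma congrD x y x' y' : congr x y -> congr x' y' -> congr (x + x') (y + y').
Proof. by rewrite /congr opprD addrACA; apply: rpredD. Qed.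
Lemma congrN x y : congr x y -> congr (- x) (- y).
Proof. by rewrite /congr -opprD rpredN. Qed.
Lemma congr_int x y : congr x y -> y \in O -> x \in O.
Proof. by move=> /nonunits_sub xy yO; rewrite -(subrK y x) rpredD. Qed.
Lemma congrM x y x' y' : y \in O -> x' \in O ->
  congr x y -> congr x' y' -> congr (x * x') (y * y').
Proof.
move=> yO x'O xy x'y'; rewrite /congr.
have -> : x * x' - y * y' = (x - y) * x' + y * (x' - y').
  by rewrite mulrBl mulrBr addrA subrK.
by apply: rpredD; [apply: nonunitsMr | apply: nonunitsM].
Qed.
Lemma congrX n x y : y \in O -> congr x y -> congr (x ^+ n) (y ^+ n).
Proof.
move=> yO xy; elim: n => [|n IHn]; first exact: congr_refl.
by rewrite !exprS congrM // rpredX // (congr_int xy).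
Qed.
Lemma congr_sum (I : Type) (rs : seq I) (f g : I -> E) :
  (forall i, congr (f i) (g i)) ->
  congr (\sum_(i <- rs) f i) (\sum_(i <- rs) g i).
Proof.
move=> fg; elim: rs => [|i rs IHrs]; first by rewrite !big_nil congr_refl.
by rewrite !big_cons congrD.
Qed.

Definition units : {pred E} := [pred x | (x \in O) && (x \notin nonunits)].

Lemma unitsE x : (x \in units) = [&& x != 0, x \in O & x^-1 \in O].
Proof.
by rewrite !inE negb_or negbK andbCA.
Qed.
Lemma units_neq0 x : x \in units -> x != 0.
Proof. by rewrite unitsE => /andP[]. Qed.
Lemma units_divr : divr_closed units.
Proof.
split=> [|x y]; first by rewrite unitsE oner_neq0 invr1 rpred1.
rewrite !unitsE => /and3P[x0 xO xi] /and3P[y0 yO yi].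
by rewrite mulf_neq0 ?invr_eq0 // invf_div !rpredM.
Qed.
HB.instance Definition _ := GRing.isDivClosed.Build E units units_divr.

Lemma unitsN1 : -1 \in units.
Proof. by rewrite unitsE invrN1 rpredN1 oppr_eq0 oner_eq0. Qed.

Lemma congr_units x y : congr x y -> y \in units -> x \in units.
Proof.
move=> xy /andP[yO yu]; apply/andP; split; first exact: congr_int xy yO.
by apply: contra yu => xm; rewrite -(subKr x y) rpredB.
Qed.

Lemma congr1_units x : congr x 1 -> x \in units.
Proof. by move=> /congr_units; apply; apply: rpred1. Qed.

Lemma units_root n x : (0 < n)%N -> x ^+ n \in units -> x \in units.
Proof.
case: n => // n _; rewrite !unitsE expf_eq0 /= => /and3P[x0 xO xi]; rewrite x0 /=.
have pow_m y : y \in nonunits -> y ^+ n.+1 \in nonunits.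
  by move=> ym; rewrite exprS nonunitsMr // rpredX // nonunits_sub.
apply/andP; split.
  have [//|xO'] := boolP (x \in O); have [_ /pow_m] := notin_val xO'.
  by rewrite nonunitsP ?expf_neq0 ?invr_eq0 // exprVn invrK xO.
have [//|xO'] := boolP (x^-1 \in O); have [_] := notin_val xO'.
by rewrite invrK => /pow_m; rewrite nonunitsP ?expf_neq0 // xi.
Qed.

Lemma congr1_divr x y : congr x 1 -> congr y 1 -> congr (x / y) 1.
Proof.
move=> x1 y1; have := congr1_units y1; rewrite unitsE => /and3P[y0 yO yi].
rewrite /congr -(divff y0) -mulrBl mulrC nonunitsM //.
exact: congr_trans x1 (congr_sym y1).
Qed.

Lemma valuation_root n x : (0 < n)%N -> x ^+ n \in O -> x \in O.
Proof.
move=> n_gt0 xnO; have [//|xO] := boolP (x \in O).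
have [x0 xm] := notin_val xO; have := nonunits1; rewrite -(expr1n _ n) -(divff x0) exprMn.
rewrite nonunitsM //; case: n n_gt0 {xnO} => // n _.
by rewrite exprS nonunitsMr // rpredX // nonunits_sub.
Qed.

Lemma nonunits_morph (s s' : {rmorphism E -> E}) x :
  cancel s s' -> (forall y, y \in O -> s' y \in O) -> x \in nonunits ->
  s x \in nonunits.
Proof.
move=> sK s'O xm; have [->|x0] := eqVneq x 0; first by rewrite rmorph0 nonunits0.
rewrite nonunitsP ?fmorph_eq0 // -fmorphV; apply/negP => /s'O.
by rewrite sK; apply/negP; rewrite -nonunitsP.
Qed.

End ValuationRing.

(** * Hensel's lemma *)

Section Hensel.
Variables (R : realType) (B : fieldType) (v : B -> R).
Hypotheses (v_abs : nonarch_abs v) (v_compl : abs_complete v).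

Lemma abs_ge0 x : 0 <= v x. Proof. by case: v_abs. Qed.
Lemma abs0 : v 0 = 0. Proof. by case: v_abs => _ /(_ 0)[_ ->]. Qed.
Lemma abs_eq0 x : v x = 0 -> x = 0. Proof. by case: v_abs => _ /(_ x)[]. Qed.
Lemma absM x y : v (x * y) = v x * v y. Proof. by case: v_abs. Qed.
Lemma absD x y : v (x + y) <= Num.max (v x) (v y). Proof. by case: v_abs. Qed.
Lemma abs_gt0 x : x != 0 -> 0 < v x.
Proof. by move=> x0; rewrite lt_def abs_ge0 andbT; apply: contra_neq x0; apply: abs_eq0. Qed.
Lemma abs1 : v 1 = 1.
Proof.
have := absM 1 1; rewrite mulr1 -{1}[v 1]mulr1 => /mulfI -> //.
by rewrite gt_eqF // abs_gt0 // oner_neq0.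
Qed.
Lemma absN x : v (- x) = v x.
Proof.
suff N1 : v (-1) = 1 by rewrite -mulN1r absM N1 mul1r.
have := absM (-1) (-1); rewrite mulrNN mulr1 abs1 => /esym/eqP.
by rewrite -expr2 sqrp_eq1 ?abs_ge0 // => /eqP.
Qed.
Lemma absX x n : v (x ^+ n) = v x ^+ n.
Proof. by elim: n => [|n IHn]; rewrite ?abs1 // !exprS absM IHn. Qed.
Lemma absV x : v x^-1 = (v x)^-1.
Proof.
have [->|x0] := eqVneq x 0; first by rewrite invr0 abs0 invr0.
by apply: (mulfI (lt0r_neq0 (abs_gt0 x0))); rewrite -absM !divff ?abs1 // lt0r_neq0 ?abs_gt0.
Qed.
Lemma absD_le e x y : v x <= e -> v y <= e -> v (x + y) <= e.
Proof. by move=> xe ye; rewrite (le_trans (absD x y)) // ge_max xe. Qed.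
Lemma absB_le e x y : v x <= e -> v y <= e -> v (x - y) <= e.
Proof. by move=> xe ye; rewrite absD_le // absN. Qed.
Lemma abs_sum_le e (I : Type) (rs : seq I) (P : pred I) (f : I -> B) :
  0 <= e -> (forall i, P i -> v (f i) <= e) -> v (\sum_(i <- rs | P i) f i) <= e.
Proof.
move=> e0 fe; elim/big_rec: _ => [|i x Pi xe]; first by rewrite abs0.
by rewrite absD_le // fe.
Qed.

(** An upper bound on the Gauss norm. *)
Definition bounded_by (e : R) (p : {poly B}) := forall i, v p`_i <= e.

Lemma bounded_byD e p q : bounded_by e p -> bounded_by e q -> bounded_by e (p + q).
Proof. by move=> pe qe i; rewrite coefD absD_le. Qed.
Lemma bounded_byB e p q : bounded_by e p -> bounded_by e q -> bounded_by e (p - q).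
Proof. by move=> pe qe i; rewrite coefB absB_le. Qed.
Lemma bounded_byM e e' p q : 0 <= e -> 0 <= e' ->
  bounded_by e p -> bounded_by e' q -> bounded_by (e * e') (p * q).
Proof.
move=> e0 e'0 pe qe i; rewrite coefM abs_sum_le ?mulr_ge0 // => j _.
by rewrite absM ler_pM ?abs_ge0.
Qed.
Lemma bounded_byW e e' p : e <= e' -> bounded_by e p -> bounded_by e' p.
Proof. by move=> ee' pe i; rewrite (le_trans (pe i)). Qed.

Lemma bounded_division e (D G : {poly B}) :
  0 <= e -> G \is monic -> bounded_by 1 G -> bounded_by e D ->
  exists s t : {poly B}, [/\ D = G * s + t, (size t < size G)%N,
    (size s <= size D - (size G).-1)%N, bounded_by e s & bounded_by e t].
Proof.
move=> e0 G_mon G1; have szG_gt0 : (0 < size G)%N by rewrite size_poly_gt0 monic_neq0.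
move: {2}(size D) (leqnn (size D)) => n.
elim: n D => [|n IHn] D szD De.
  exists 0, 0; rewrite mulr0 addr0 size_poly0 size_poly_gt0 monic_neq0 //.
  split=> //; first by apply/eqP; rewrite -size_poly_eq0 -leqn0.
    by move=> i; rewrite coef0 abs0.
  by move=> i; rewrite coef0 abs0.
have [szDG|szGD] := ltnP (size D) (size G).
  exists 0, D; rewrite mulr0 add0r size_poly0; split=> //.
  by move=> i; rewrite coef0 abs0.
have [D0|D_neq0] := eqVneq D 0.
  by move: szGD; rewrite D0 size_poly0 leqn0 size_poly_eq0 (negbTE (monic_neq0 G_mon)).
pose m : {poly B} := lead_coef D *: 'X^(size D - size G).
have m_e : bounded_by e m.
  move=> i; rewrite coefZ coefXn; case: eqP => _; first by rewrite mulr1; apply: De.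
  by rewrite mulr0 abs0.
have szD' : (size (D - G * m)%R < size D)%N.
  have Gm : size (G * m) = size D.
    rewrite size_monicM // ?scaler_eq0 ?lead_coef_eq0 ?(negbTE D_neq0) ?monic_neq0 ?monicXn //.
    rewrite size_scale ?lead_coef_eq0 // size_polyXn addnS /=.
    by rewrite subnKC.
  have lGm : lead_coef (G * m) = lead_coef D.
    by rewrite lead_coef_monicM // lead_coefZ lead_coefXn mulr1.
  rewrite ltnNge; apply/negP => le_size.
  have : (size (D - G * m)).-1 = (size D).-1.
    congr _.-1; apply/eqP; rewrite eqn_leq le_size andbT.
    by rewrite (leq_trans (size_polyD _ _)) // size_polyN Gm maxnn.
  move=> sz; have : lead_coef (D - G * m) = 0.
    by rewrite /lead_coef sz coefB -{2}Gm -!/(lead_coef _) lGm subrr.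
  move=> /eqP; rewrite lead_coef_eq0 => /eqP DGm; move: le_size.
  by rewrite DGm size_poly0 leqn0 size_poly_eq0 (negbTE D_neq0).
have [|s [t [DE szt szs se te]]] := IHn (D - G * m) (leq_trans szD' szD).
  by apply: bounded_byB => //; rewrite -[e]mul1r; apply: bounded_byM.
exists (s + m), t; split=> //.
- by rewrite mulrDr addrAC -DE subrK.
- rewrite (leq_trans (size_polyD _ _)) // geq_max.
  rewrite (leq_trans szs) ?leq_sub2r ?(ltnW szD') //=.
  rewrite (leq_trans (size_scale_leq _ _)) // size_polyXn.
  by rewrite -subSn // -[in leqLHS](prednK szG_gt0) subSS.
- exact: bounded_byD.
Qed.

Lemma geometric_small (th eps : R) : 0 <= th < 1 -> 0 < eps -> exists k, th ^+ k < eps.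
Proof.
move=> /andP[th0 th1] eps0.
have [->|th_neq0] := eqVneq th 0; first by exists 1%N; rewrite expr1.
have th_gt0 : 0 < th by rewrite lt_def th_neq0.
pose y := th^-1 - 1; have y_gt0 : 0 < y by rewrite subr_gt0 invf_gt1.
have bernoulli k : 1 + y * k%:R <= (1 + y) ^+ k.
  elim: k => [|k IHk]; first by rewrite mulr0 addr0.
  apply: le_trans (_ : (1 + y) * (1 + y * k%:R) <= _); last first.
    by rewrite exprS ler_pM2l ?IHk // addr_gt0.
  rewrite -subr_ge0 -natr1.
  have -> : (1 + y) * (1 + y * k%:R) - (1 + y * (k%:R + 1)) = y * y * k%:R by ring.
  by rewrite !mulr_ge0 // ltW.
exists (Num.bound (eps^-1 / y)).
have : eps^-1 < (1 + y) ^+ Num.bound (eps^-1 / y).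
  apply: lt_le_trans (bernoulli _); rewrite ltr_wpDl //.
  by rewrite mulrC -ltr_pdivrMr // archi_boundP // ltW // divr_gt0 ?invr_gt0.
rewrite /y addrCA subrr addr0 exprVn ltf_pV2 // posrE ?exprn_gt0 ?invr_gt0 //.
Qed.

Lemma abs_geometric_eq0 (th : R) x : 0 <= th < 1 -> (forall k, v x <= th ^+ k) -> x = 0.
Proof.
move=> th01 x_le; apply/eqP; apply: contraT => /abs_gt0 x_gt0.
have [k] := geometric_small th01 x_gt0.
by rewrite ltNge x_le.
Qed.

Lemma poly_limit n (P : nat -> {poly B}) (th : R) :
  0 <= th < 1 -> (forall k, (size (P k) <= n)%N) ->
  (forall k, bounded_by (th ^+ k) (P k.+1 - P k)) ->
  exists Q : {poly B}, forall k, bounded_by (th ^+ k) (P k - Q).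
Proof.
move=> /andP[th0 th1] szP stepP.
have distP k d : bounded_by (th ^+ k) (P (k + d)%N - P k).
  elim: d => [|d IHd]; first by rewrite addn0 subrr => i; rewrite coef0 abs0 exprn_ge0.
  rewrite addnS -(subrKA (P (k + d)%N)); apply: bounded_byD => //.
  apply: bounded_byW (stepP _).
  by rewrite exprD ler_piMr ?exprn_ge0 // exprn_ile1 // ltW.
have lim i : exists l, forall eps, 0 < eps -> exists N, forall n,
    (N <= n)%N -> v ((P n)`_i - l) < eps.
  apply: v_compl => eps eps0; have [|k k_eps] := @geometric_small th eps _ eps0.
    by rewrite th0.
  exists k => a b ka kb; apply: le_lt_trans k_eps.
  rewrite -(subrKA (P k)`_i) absD_le // -coefB.
    by rewrite -(subnKC ka); apply: distP.
  by rewrite -absN -coefN opprB -(subnKC kb); apply: distP.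
pose l i := sval (cid (lim i)).
have lP i eps : 0 < eps -> exists N, forall n, (N <= n)%N -> v ((P n)`_i - l i) < eps.
  by apply: (svalP (cid (lim i))).
exists (\poly_(i < n) l i) => k i; rewrite coefB coef_poly.
case: ltnP => [_|ni]; last first.
  by rewrite subr0 nth_default ?abs0 ?exprn_ge0 // (leq_trans (szP k)).
rewrite leNgt; apply/negP => lt_k.
have pos : 0 < v ((P k)`_i - l i) by apply: le_lt_trans lt_k; rewrite exprn_ge0.
have [N PN] := lP i _ pos.
have lt_N := PN (k + N)%N (leq_addl _ _).
have Pk : v ((P (k + N)%N)`_i - (P k)`_i) <= th ^+ k by rewrite -coefB; apply: distP.
have := absD ((P k)`_i - (P (k + N)%N)`_i) ((P (k + N)%N)`_i - l i).
rewrite subrKA leNgt gt_max lt_N andbT.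
by rewrite -absN opprB (le_lt_trans Pk).
Qed.

(** Let r be the last index at which |f_i| is maximal, and suppose that r is
    neither 0 nor the degree. Normalised so that its coefficient of index r is 1,
    f is congruent to a monic G of degree r modulo coefficients of absolute value
    at most th < 1. Starting from (G, 1), divide the error g - G q by G, add the
    remainder to G and the quotient to q: the new error is th times smaller, and
    the limit is a factor of f of degree r. *)
Lemma irreducible_coef_le (f : {poly B}) :
  irreducible_poly f -> forall i, v f`_i <= Num.max (v f`_0) (v (lead_coef f)).
Proof.
move=> [szf_gt1 f_irr] i0; rewrite leNgt; apply/negP; rewrite gt_max => /andP[i0_0 i0_lead].
have f_neq0 : f != 0 by rewrite -size_poly_gt0 ltnW.
pose P j := (j < size f)%N && [forall k : 'I_(size f), v f`_k <= v f`_j].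
have exP : exists j, P j.
  have szf_gt0 : (0 < size f)%N by rewrite ltnW.
  have [j _ jmax] := @Order.TotalTheory.arg_maxP _ _ _ (Ordinal szf_gt0) xpredT
     (fun k : 'I_(size f) => v f`_k) isT.
  by exists j; rewrite /P ltn_ord; apply/forallP => k; apply: jmax.
have ubP j : P j -> (j <= size f)%N by move=> /andP[/ltnW].
case: (ex_maxnP exP ubP) => r /andP[r_lt /forallP r_max] r_last.
have {}r_max j : v f`_j <= v f`_r.
  have [jf|fj] := ltnP j (size f); first exact: (r_max (Ordinal jf)).
  by rewrite nth_default // abs0 abs_ge0.
have {}r_last j : (r < j)%N -> v f`_j < v f`_r.
  move=> rj; rewrite lt_neqAle r_max andbT; apply: contraTneq rj => jr.
  rewrite -leqNgt; have [jf|fj] := ltnP j (size f); last first.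
    exfalso; move: i0_0; rewrite ltNge; apply/negP/negPn.
    by rewrite (le_trans (r_max i0)) // -jr nth_default // abs0 abs_ge0.
  by apply: r_last; rewrite /P jf; apply/forallP => k; rewrite jr.
have fr_gt0 : 0 < v f`_r.
  by apply: lt_le_trans (r_max i0); apply: le_lt_trans i0_0; apply: abs_ge0.
have fr_neq0 : f`_r != 0 by apply: contraTneq fr_gt0 => ->; rewrite abs0 ltxx.
have r_gt0 : (0 < r)%N.
  by rewrite lt0n; apply: contraTneq i0_0 => r0; rewrite -leNgt -r0.
have r_lt1 : (r.+1 < size f)%N.
  rewrite ltn_neqAle r_lt andbT; apply: contraTneq i0_lead => rf.
  by rewrite -leNgt /lead_coef -rf.
pose g := (f`_r)^-1 *: f.
have vg j : v g`_j = v f`_j / v f`_r by rewrite coefZ mulrC absM absV.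
have g1 : bounded_by 1 g by move=> j; rewrite vg ler_pdivrMr // mul1r.
have gr : g`_r = 1 by rewrite coefZ mulVf.
have szg : size g = size f by rewrite size_scale ?invr_eq0.
have [th th01 th_g] : exists2 th, 0 <= th < 1 & forall j, (r < j)%N -> v g`_j <= th.
  exists (\big[Num.max/0]_(j < size f | (r < j)%N) v g`_j).
    apply/andP; split; first by rewrite bigmax_idl le_max lexx.
    by apply/bigmax_ltP; split=> // j rj; rewrite vg ltr_pdivrMr // mul1r r_last.
  move=> j rj; have [jf|fj] := ltnP j (size f).
    exact: (@le_bigmax_cond _ _ _ _ (Ordinal jf) (fun j : 'I_(size f) => (r < j)%N)
      (fun j => v g`_j)).
  by rewrite nth_default ?szg // abs0 bigmax_idl le_max lexx.
have /andP[th0 th1] := th01.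
pose inv k (x : {poly B} * {poly B}) := [/\ x.1 \is monic, size x.1 = r.+1,
  bounded_by 1 x.1, (size x.2 <= size f - r)%N
  & bounded_by th (x.2 - 1) /\ bounded_by (th ^+ k.+1) (g - x.1 * x.2)].
pose close k (x y : {poly B} * {poly B}) :=
  bounded_by (th ^+ k) (y.1 - x.1) /\ bounded_by (th ^+ k) (y.2 - x.2).
have step k x : inv k x -> exists y, inv k.+1 y /\ close k x y.
  case: x => G q [/= G_mon szG G1 szq [q1 Gq]].
  have thk0 : 0 <= th ^+ k.+1 by rewrite exprn_ge0.
  have thk1 : th ^+ k.+1 <= th ^+ k by rewrite exprS ler_piMl ?exprn_ge0 // ltW.
  have thk2 : th ^+ k.+1 <= th by rewrite exprS ler_piMr // exprn_ile1 // ltW.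
  have szD : (size (g - G * q)%R <= size f)%N.
    rewrite (leq_trans (size_polyD _ _)) // geq_max szg leqnn size_polyN /=.
    rewrite (leq_trans (size_polyMleq _ _)) // szG addSn /=.
    by rewrite -(subnKC (ltnW r_lt)) leq_add2l.
  have [s [t [DE szt szs se te]]] := bounded_division thk0 G_mon G1 Gq.
  rewrite szG /= in szt szs.
  exists (G + t, q + s); split; first split=> /=.
  - by rewrite monicE lead_coefDl ?szG // -monicE.
  - by rewrite size_polyDl szG.
  - apply: bounded_byD => //; apply: bounded_byW te.
    by rewrite exprn_ile1 // ltW.
  - rewrite (leq_trans (size_polyD _ _)) // geq_max szq.
    by rewrite (leq_trans szs) // leq_sub2r.
  - have qs1 : bounded_by th (q + s - 1).
      by rewrite addrAC; apply: bounded_byD => //; apply: bounded_byW se.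
    split=> //.
    (* Both factors are small, since q + s is close to 1. *)
    have -> : g - (G + t) * (q + s) = - (t * (q + s - 1)).
      by rewrite -[g](subrK (G * q)) DE; ring.
    move=> i; rewrite coefN absN exprSr; apply: bounded_byM => //.
  - by split=> /=; rewrite addrAC subrr add0r; apply: bounded_byW thk1 _.
pose G0 := take_poly r.+1 g.
have coefG0 j : G0`_j = if (j < r.+1)%N then g`_j else 0 by rewrite coef_take_poly.
have inv0 : inv 0%N (G0, 1).
  have szG0 : size G0 = r.+1.
    apply/eqP; rewrite eqn_leq size_take_poly /=.
    by rewrite ltnNge; apply/negP => /leq_sizeP/(_ r (leqnn r)) /eqP;
       rewrite coefG0 ltnSn gr oner_eq0.
  split=> //=.
  - by rewrite monicE /lead_coef szG0 coefG0 ltnSn gr.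
  - by move=> j; rewrite coefG0; case: ifP => _; [apply: g1|rewrite abs0].
  - by rewrite size_poly1 subn_gt0.
  - split; first by move=> j; rewrite subrr coef0 abs0.
    move=> j; rewrite mulr1 coefB coefG0 expr1; case: ltnP => [_|rj].
      by rewrite subrr abs0.
    by rewrite subr0 th_g.
have [F [F0 FS]] : exists F : nat -> {poly B} * {poly B}, inv 0%N (F 0%N) /\
    forall k, inv k (F k) -> inv k.+1 (F k.+1) /\ close k (F k) (F k.+1).
  have next k x : exists y, inv k x -> inv k.+1 y /\ close k x y.
    have [/step[y yP]|no] := pselect (inv k x); first by exists y.
    by exists x.
  pose nx k x := sval (cid (next k x)).
  pose F := fix F k := if k is k'.+1 then nx k' (F k') else (G0, 1).
  by exists F; split=> // k invk; apply: (svalP (cid (next k (F k)))).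
have invF k : inv k (F k) by elim: k => // k /FS[].
have closeF k : close k (F k) (F k.+1) by have [] := FS k (invF k).
have szF1 k : (size (F k).1 <= size f)%N by have [_ -> _ _ _] := invF k; apply: ltnW.
have szF2 k : (size (F k).2 <= size f)%N.
  by have [_ _ _ szq _] := invF k; apply: leq_trans szq _; apply: leq_subr.
have [G limG] := poly_limit th01 szF1 (fun k => proj1 (closeF k)).
have [q limq] := poly_limit th01 szF2 (fun k => proj2 (closeF k)).
have G_coef j c : (forall k, (F k).1`_j = c) -> G`_j = c.
  move=> Fc; apply/esym/eqP; rewrite -subr_eq0; apply/eqP.
  by apply: (abs_geometric_eq0 th01) => k; rewrite -(Fc k) -coefB; apply: limG.
have Gr : G`_r = 1.
  by apply: G_coef => k; have [/monicP Fr szF _ _ _] := invF k; rewrite -Fr /lead_coef szF.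
have szG : size G = r.+1.
  apply/eqP; rewrite eqn_leq; apply/andP; split.
    apply/leq_sizeP => j rj; apply: G_coef => k.
    by have [_ szF _ _ _] := invF k; rewrite nth_default // szF.
  by rewrite ltnNge; apply/negP => /leq_sizeP/(_ r (leqnn r))/eqP; rewrite Gr oner_eq0.
have G1 : bounded_by 1 G.
  rewrite -[G](subKr (F 0%N).1); have [_ _ F1 _ _] := invF 0%N.
  by apply: bounded_byB => //; rewrite -(expr0 th); apply: limG.
have gE : g = G * q.
  apply/eqP; rewrite -subr_eq0; apply/eqP/polyP => j; rewrite coef0.
  apply: (abs_geometric_eq0 th01) => k; move: j.
  have [_ _ _ _ [q1 Gq]] := invF k.
  have q1' : bounded_by 1 (F k).2.
    rewrite -[(F k).2](subrK 1); apply: bounded_byD.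
      by apply: bounded_byW q1; apply: ltW.
    by move=> j; rewrite coef1; case: eqP => _; rewrite ?abs1 ?abs0.
  have -> : g - G * q = (g - (F k).1 * (F k).2) +
      (((F k).1 - G) * (F k).2 + G * ((F k).2 - q)).
    by rewrite mulrBl mulrBr subrKA addrA subrK.
  apply: bounded_byD; last apply: bounded_byD.
  - by apply: bounded_byW Gq; rewrite exprS ler_piMl ?exprn_ge0 // ltW.
  - by rewrite -[th ^+ k]mulr1; apply: bounded_byM; rewrite ?exprn_ge0.
  - by rewrite -[th ^+ k]mul1r; apply: bounded_byM; rewrite ?exprn_ge0.
have Gf : G %| f by rewrite -(@dvdpZr _ (f`_r)^-1) ?invr_eq0 // -/g gE dvdp_mulr.
have := f_irr G; rewrite szG eqSS -lt0n => /(_ r_gt0 Gf)/eqp_size.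
by rewrite szG => rf; rewrite rf ltnn in r_lt1.
Qed.

End Hensel.

(** * The integral closure of a complete valuation ring *)

Lemma prod_scale_seq (A : comNzRingType) (I : Type) (rs : seq I) (c : A) (g : I -> A) :
  \prod_(i <- rs) (c * g i) = c ^+ size rs * \prod_(i <- rs) g i.
Proof. by rewrite big_split /= big_const_seq count_predT iter_mulr_1. Qed.

Section IntegralClosure.
Variables (R : realType) (B : fieldType) (v : B -> R) (v_abs : nonarch_abs v).
Variables (E : closedFieldType) (j : {rmorphism B -> E}).

Fact integers_subring : subring_closed (integers v).
Proof.
split=> [|x y xO yO|x y xO yO].
- by rewrite inE (abs1 v_abs).
- by rewrite inE (absB_le v_abs).
- by rewrite inE (absM v_abs) mulr_ile1 ?(abs_ge0 v_abs).
Qed.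

HB.instance Definition _ :=
  GRing.isSubringClosed.Build B (integers v) integers_subring.

Record integer_ring : Type := IntegerRing {
  integer_val :> B;
  integer_valP : integer_val \in integers v }.

HB.instance Definition _ := [isSub for integer_val].
HB.instance Definition _ := [Choice of integer_ring by <:].
HB.instance Definition _ := [SubChoice_isSubComNzRing of integer_ring by <:].

Definition integral_closure : {pred E} := [pred x | `[< exists p : {poly B},
  [/\ p \is monic, p \is a polyOver (integers v) & root (map_poly j p) x] >]].

Let OB : comNzRingType := integer_ring.
Let val_rm : {rmorphism OB -> B} := \val.
Let incl : {rmorphism OB -> E} := j \o val_rm.

Let integral_closureE x : (x \in integral_closure) <-> integralOver incl x.
Proof.
have comp_map (p : {poly OB}) : map_poly incl p = map_poly j (map_poly val_rm p).
  by rewrite -map_poly_comp.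
split=> [/asboolP[p [p_mon pO px]]|[p p_mon px]]; last first.
  apply/asboolP; exists (map_poly val_rm p); split; last by rewrite -comp_map.
    exact: monic_map.
  by apply/polyOverP => i; rewrite coef_map; apply: integer_valP.
have coefO i : p`_i \in integers v by apply: (polyOverP pO).
pose P : {poly OB} := \poly_(i < size p) (IntegerRing (coefO i) : OB).
have PE : map_poly val_rm P = p.
  apply/polyP => i; rewrite coef_map coef_poly; case: ltnP => // szp.
  by rewrite raddf0 nth_default.
exists P; last by rewrite comp_map PE.
have szP : size P = size p.
  apply/eqP; rewrite eqn_leq size_poly -{1}PE size_poly //.
rewrite monicE; apply/eqP/val_inj => /=.
by rewrite -[\val _]/(val_rm P`_(size P).-1) -coef_map PE szP; apply/monicP.
Qed.

Lemma integral_closure_subring : subring_closed integral_closure.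
Proof.
split=> [|x y /integral_closureE xO /integral_closureE yO
         |x y /integral_closureE xO /integral_closureE yO]; apply/integral_closureE.
- exact: integral1.
- exact: integral_sub.
- exact: integral_mul.
Qed.

Lemma integral_closure_fixes (s : {rmorphism E -> E}) x :
  fixes j s -> x \in integral_closure -> s x \in integral_closure.
Proof.
move=> s_fix /asboolP[p [p_mon pO px]]; apply/asboolP.
by exists p; split=> //; apply: fixes_root.
Qed.

(** If |x| > 1, the leading power of x dominates a monic integral equation. *)
Lemma integral_abs_le1 (K : fieldType) (w : K -> R) (i : {rmorphism B -> K})
    (p : {poly B}) (x : K) :
  nonarch_abs w -> (forall b, w (i b) = v b) ->
  p \is monic -> p \is a polyOver (integers v) -> root (map_poly i p) x -> w x <= 1.
Proof.
move=> w_abs wi p_mon pO px; rewrite leNgt; apply/negP => x_gt1.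
have [n szp] : exists n, size p = n.+1.
  by exists (size p).-1; rewrite prednK // size_poly_gt0 monic_neq0.
have szip : size (map_poly i p) = n.+1 by rewrite size_map_poly.
have pn : (map_poly i p)`_n = 1.
  have /monicP : map_poly i p \is monic by rewrite map_monic.
  by rewrite /lead_coef szip.
move: px; rewrite /root horner_coef szip big_ord_recr /= pn mul1r addr_eq0 => /eqP sum_x.
have : w (x ^+ n) <= w x ^+ n.-1.
  rewrite -(absN w_abs) -sum_x; apply: (abs_sum_le w_abs).
    by rewrite exprn_ge0 // (abs_ge0 w_abs).
  move=> k _; rewrite (absM w_abs) coef_map wi (absX w_abs).
  apply: le_trans (_ : 1 * w x ^+ k <= _).
    by rewrite ler_wpM2r ?exprn_ge0 ?(abs_ge0 w_abs) //; apply: (polyOverP pO).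
  rewrite mul1r ler_weXn2l ?ltW //.
  by have := ltn_ord k; case: (n) k => [[]//|m k]; rewrite ltnS.
rewrite (absX w_abs); case: (n) sum_x => [|m] sum_x.
  by move: sum_x; rewrite big_ord0 expr0 => /eqP; rewrite eq_sym oppr_eq0 oner_eq0.
by rewrite leNgt /= exprS ltr_pMl ?x_gt1 // exprn_gt0 // (lt_trans ltr01).
Qed.

Lemma integral_closure_base b : (j b \in integral_closure) = (v b <= 1).
Proof.
apply/idP/idP => [/asboolP[p [p_mon pO px]]|vb].
  apply: (@integral_abs_le1 B v idfun p b) => //.
  rewrite map_poly_id //.
  by rewrite fmorph_root in px.
apply/asboolP; exists ('X - b%:P); split; first exact: monicXsubC.
  by rewrite polyOverXsubC.
by rewrite map_polyXsubC root_XsubC.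
Qed.

Hypotheses (v_compl : abs_complete v) (j_alg : algebraic_closure j).

(** By [irreducible_coef_le], the minimal polynomial f of x is integral if |f_0| <= 1,
    and otherwise the reversed polynomial of f, divided by f_0, is integral. *)
Lemma integral_closure_val x : x \in integral_closure \/ x^-1 \in integral_closure.
Proof.
have [f [f_mon f_irr fx]] := algebraic_irreducible_root (j_alg x).
have coef_le := irreducible_coef_le v_abs v_compl f_irr.
rewrite (monicP f_mon) (abs1 v_abs) in coef_le.
have [f0_le1|f0_gt1] := leP (v f`_0) 1.
  left; apply/asboolP; exists f; split=> //; apply/polyOverP => i.
  by rewrite inE (le_trans (coef_le i)) // ge_max f0_le1 lexx.
right; have [->|x_neq0] := eqVneq x 0.
  have [O1 OB' _] := integral_closure_subring.
  by rewrite invr0 -(subrr 1) OB'.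
pose n := (size f).-1.
have szf : size f = n.+1 by rewrite prednK // size_poly_gt0 monic_neq0.
have f0_neq0 : f`_0 != 0 by apply: contraTneq f0_gt1 => ->; rewrite (abs0 v_abs) ltr10.
pose g := \poly_(i < n.+1) ((f`_0)^-1 * f`_(n - i)).
have gn : g`_n = 1 by rewrite coef_poly ltnSn subnn mulVf.
have szg : size g = n.+1.
  apply/eqP; rewrite eqn_leq size_poly ltnNge /=.
  by apply/negP => /leq_sizeP/(_ n (leqnn n))/eqP; rewrite gn oner_eq0.
apply/asboolP; exists g; split.
- by rewrite monicE /lead_coef szg gn.
- apply/polyOverP => i; rewrite coef_poly; case: ifP => _; last by rewrite rpred0.
  rewrite inE (absM v_abs) (absV v_abs) mulrC ler_pdivrMr ?(lt_trans ltr01) // mul1r.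
  by rewrite (le_trans (coef_le _)) // ge_max lexx ltW.
- apply/eqP; apply: (mulfI (expf_neq0 n x_neq0)).
  transitivity ((j f`_0)^-1 * (map_poly j f).[x]); last by rewrite (rootP fx) !mulr0.
  rewrite !horner_coef !size_map_poly szg szf !big_distrr /=.
  rewrite [RHS](reindex_inj rev_ord_inj) /=; apply: eq_bigr => i _.
  have i_le : (i <= n)%N by rewrite -ltnS.
  have xE : x ^+ (n - i) = x ^+ n * x^-1 ^+ i.
    by rewrite exprVn; apply: (canRL (mulfK (expf_neq0 i x_neq0))); rewrite -exprD subnK.
  rewrite !coef_map coef_poly ltn_ord /= rmorphM fmorphV subSS xE.
  by rewrite mulrCA !mulrA.
Qed.

Definition integral_closure_valuation : valuation_subring E :=
  ValuationSubring integral_closure_subring integral_closure_val.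

Let O := integral_closure_valuation.
Let m := nonunits O.

(** An automorphism has finite order on x, so the product of the conjugates of
    u = s x / x along the orbit is 1; all of them are in the maximal ideal if u is. *)
Lemma fixes_quot_units (s : {rmorphism E -> E}) x :
  fixes j s -> x != 0 -> s x / x \in units O.
Proof.
move=> s_fix x_neq0.
suff wlog_quot (t : {rmorphism E -> E}) y : fixes j t -> y != 0 -> t y / y \notin m.
  have [s' [s'_fix sK s'K]] := fixes_inverse j_alg s_fix.
  have sx0 : s x != 0 by rewrite fmorph_eq0.
  have := wlog_quot s' (s x) s'_fix sx0; rewrite sK => /unit_val[_].
  by rewrite invf_div => quotO; rewrite inE quotO wlog_quot.
move=> {s s_fix x x_neq0} t_fix y_neq0; apply/negP => quot_m.
have t_m z : z \in m -> t z \in m.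
  have [t' [t'_fix tK _]] := fixes_inverse j_alg t_fix.
  apply: (nonunits_morph tK) => w; exact: integral_closure_fixes.
have iter_m n : iter n.+1 t y / y \in m.
  elim: n => // n IHn; set z := iter n.+1 t y in IHn *.
  have -> : iter n.+2 t y / y = t (z / y) * (t y / y).
    by rewrite rmorphM fmorphV /= mulrA divfK // fmorph_eq0.
  apply: nonunitsM => //; apply: nonunits_sub.
  exact: t_m.
have [[//|n] _ ty] := fixes_periodic j_alg y t_fix.
have := iter_m n; rewrite ty divff // => m1.
by have := nonunits1 O; rewrite m1.
Qed.

(** For c take the constant coefficient of the minimal polynomial: up to sign it is
    the product of the conjugates of x, which are unit multiples of x. *)
Lemma power_over_base (p : {poly B}) (x : E) :
  p != 0 -> root (map_poly j p) x -> x != 0 ->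
  exists (d : nat) (c : B), [/\ (0 < d)%N, (d < size p)%N, c != 0
    & x ^+ d / j c \in units O].
Proof.
move=> p_neq0 px x_neq0.
have [f [rs [f_mon f_irr frs xrs rs_conj]]] := min_poly_conjugates j_alg x.
have fx : root (map_poly j f) x by rewrite frs root_prod_XsubC.
have szf : size f = (size rs).+1 by rewrite -(size_map_poly j) frs size_prod_XsubC.
have rs_gt0 : (0 < size rs)%N by case: (rs) xrs.
have jf0 : j f`_0 = (-1) ^+ size rs * \prod_(z <- rs) z.
  rewrite -horner_coef0 -horner_map rmorph0 frs horner_prod -prod_scale_seq.
  by apply: eq_bigr => z _; rewrite !hornerE mulN1r.
have f0_neq0 : f`_0 != 0.
  rewrite -(fmorph_eq0 j) jf0 mulf_neq0 ?expf_neq0 ?oppr_eq0 ?oner_eq0 //.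
  rewrite prodf_seq_neq0; apply/allP => z /rs_conj[s [_ <-]].
  by rewrite fmorph_eq0.
exists (size rs), f`_0; split=> //.
  rewrite -szf; apply: dvdp_leq => //.
  exact: irreducible_root_dvd f_irr fx px.
rewrite -[_ / _]invrK rpredV invf_div jf0 -mulrA.
have -> : (\prod_(z <- rs) z) / x ^+ size rs = \prod_(z <- rs) (x^-1 * z).
  by rewrite prod_scale_seq exprVn mulrC.
rewrite rpredM ?rpredX ?unitsN1 // big_seq rpred_prod // => z /rs_conj[s [s_fix <-]].
by rewrite mulrC fixes_quot_units.
Qed.

End IntegralClosure.

(** * Tame descent and Frobenius elements *)

Section Binomial.

Lemma logn_sub p a n i : prime p -> (p ^ a %| n)%N -> (0 < i < p ^ a)%N -> (i < n)%N ->
  logn p (n - i) = logn p i.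
Proof.
move=> p_pr pa_n /andP[i_gt0 i_lt] i_n.
have ni_gt0 : (0 < n - i)%N by rewrite subn_gt0.
have log_lt : (logn p i < a)%N.
  rewrite ltnNge -pfactor_dvdn //; apply: contraL i_lt => /(dvdn_leq i_gt0).
  by rewrite -leqNgt.
have dvd_n k : (k <= a)%N -> (p ^ k %| n)%N.
  by move=> ka; apply: dvdn_trans pa_n; apply: dvdn_exp2l.
apply/eqP; rewrite eqn_leq andbC -pfactor_dvdn //.
rewrite dvdn_sub ?dvd_n ?pfactor_dvdnn ?(ltnW log_lt) //= leqNgt -pfactor_dvdn //.
apply/negP => dvd_ni.
have : (p ^ (logn p i).+1 %| i)%N by rewrite -{2}(subKn (ltnW i_n)) dvdn_sub ?dvd_n.
by rewrite pfactor_dvdn // ltnn.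
Qed.

(** In 'C(d - 1, i) with i < p ^ a and d = p ^ a n, the factors d - k of the numerator
    and k of the denominator contain the same power of p; the case i = p ^ a - 1
    gives 'C(d, p ^ a). *)
Lemma ndvdn_bin_pfactor p a n : prime p -> (0 < n)%N -> ~~ (p %| n)%N ->
  ~~ (p %| 'C(p ^ a * n, p ^ a))%N.
Proof.
move=> p_pr n_gt0 pn; set d := (p ^ a * n)%N.
have pa_gt0 : (0 < p ^ a)%N by rewrite expn_gt0 prime_gt0.
have d_gt0 : (0 < d)%N by rewrite muln_gt0 pa_gt0.
have pa_d : (p ^ a <= d)%N by rewrite leq_pmulr.
have pa_dvd : (p ^ a %| d)%N by rewrite dvdn_mulr.
have logd : logn p d = a.
  by rewrite lognM // pfactorK // logn_coprime ?prime_coprime // addn0.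
clearbody d.
have logn_bin i : (i < p ^ a)%N -> logn p 'C(d.-1, i) = 0%N.
  elim: i => [|i IHi] i_lt; first by rewrite bin0 logn1.
  have i1_d : (i.+1 < d)%N by apply: leq_trans pa_d.
  have i_d : (i <= d.-1)%N by rewrite -ltnS prednK // ltnW.
  have eq_bin := congr1 (logn p) (mul_bin_left d.-1 i).
  have di_gt0 : (0 < d - i.+1)%N by rewrite subn_gt0.
  have dE : (d.-1 - i = d - i.+1)%N by rewrite -subn1 -subnDA add1n.
  rewrite dE !lognM ?bin_gt0 // in eq_bin; last by rewrite -ltnS prednK.
  rewrite (IHi (ltnW i_lt)) addn0 (@logn_sub p a) // in eq_bin.
  by apply/eqP; rewrite -(eqn_add2l (logn p i.+1)) eq_bin addn0.
have bin_diag := congr1 (logn p) (mul_bin_diag d (p ^ a).-1).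
rewrite prednK // !lognM ?bin_gt0 ?pa_d // in bin_diag; last by rewrite -ltnS !prednK.
rewrite logn_bin ?prednK // addn0 pfactorK // logd in bin_diag.
have {}bin_diag : logn p 'C(d, p ^ a) = 0%N.
  by apply/eqP; rewrite -(eqn_add2l a) -bin_diag addn0.
by rewrite -[X in (X %| _)%N]expn1 pfactor_dvdn ?bin_gt0 // bin_diag.
Qed.

End Binomial.

Section Tame.
Variables (K : fieldType) (E : closedFieldType) (iota : {rmorphism K -> E}).
Hypothesis iota_alg : algebraic_closure iota.
Variable O : valuation_subring E.
Hypothesis O_fixes : forall (s : {rmorphism E -> E}) x,
  fixes iota s -> x \in O -> s x \in O.
Variable p : nat.
Hypotheses (p_prime : prime p) (p_m : p%:R \in nonunits O).

Lemma nat_notin_nonunits n : ~~ (p %| n)%N -> n%:R \notin nonunits O.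
Proof.
move=> pn; apply/negP => n_m.
have n_gt0 : (0 < n)%N by rewrite lt0n; apply: contraNneq pn => ->; apply: dvdn0.
have /(coprimeP _ n_gt0)[[a b] /= ab] : coprime n p by rewrite coprime_sym prime_coprime.
have := nonunits1 O; rewrite -[1](mulr1n 1) -ab natrB; last first.
  by apply: ltnW; rewrite -subn_gt0 ab.
by rewrite !natrM rpredB // nonunitsM // rpred_nat.
Qed.

Lemma congr_expD_prime x y : x \in O -> y \in O ->
  congr O ((x + y) ^+ p) (x ^+ p + y ^+ p).
Proof.
move=> xO yO; rewrite exprDn.
have [k pk] : exists k, p = k.+1 by exists p.-1; rewrite prednK // prime_gt0.
rewrite pk big_ord_recl big_ord_recr /= subn0 !expr0 mulr1 bin0 mulr1n.
rewrite subnn expr0 mul1r binn mulr1n addrCA /congr.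
rewrite /bump /= add1n -pk addrK.
rewrite rpred_sum // => i _; rewrite add1n.
have /dvdnP[b ->] : (p %| 'C(p, i.+1))%N.
  by apply: prime_dvd_bin => //; rewrite pk !ltnS leq0n /= ltn_ord.
by rewrite mulrnA -mulr_natr nonunitsM // rpredMn // rpredM ?rpredX.
Qed.

Lemma congr_expD_pfactor t x y : x \in O -> y \in O ->
  congr O ((x + y) ^+ (p ^ t)) (x ^+ (p ^ t) + y ^+ (p ^ t)).
Proof.
move=> xO yO; elim: t => [|t IHt]; first by rewrite !expr1 congr_refl.
rewrite expnSr !exprM.
apply: congr_trans (congr_expD_prime _ _); rewrite ?rpredX //.
by apply: congrX => //; rewrite rpredD ?rpredX.
Qed.

Lemma congr_exp_sum t (I : Type) (rs : seq I) (g : I -> E) :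
  (forall i, g i \in O) ->
  congr O ((\sum_(i <- rs) g i) ^+ (p ^ t)) (\sum_(i <- rs) g i ^+ (p ^ t)).
Proof.
move=> gO; elim: rs => [|i rs IHrs].
  by rewrite !big_nil expr0n expn_eq0 eqn0Ngt prime_gt0 //= congr_refl.
rewrite !big_cons; apply: congr_trans (congr_expD_pfactor _ _ _) _ => //.
  by rewrite rpred_sum.
by apply: congrD => //; apply: congr_refl.
Qed.

Lemma congr_fixes (s : {rmorphism E -> E}) x y :
  fixes iota s -> congr O x y -> congr O (s x) (s y).
Proof.
move=> s_fix; rewrite /congr -rmorphB.
have [s' [s'_fix sK _]] := fixes_inverse iota_alg s_fix.
by apply: (nonunits_morph sK) => z; apply: O_fixes.
Qed.

(** The coefficients of the minimal polynomial f of z are congruent to their q-th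
    powers, so f (z ^ q) is congruent to f (z) ^ q = 0, and z ^ q to a conjugate of z. *)
Lemma exists_frobenius t (z : E) :
  (forall c, iota c \in O -> congr O (iota c ^+ (p ^ t)) (iota c)) -> z \in O ->
  exists2 s, fixes iota s & congr O (s z) (z ^+ (p ^ t)).
Proof.
move=> residue zO; set q := (p ^ t)%N in residue *.
have [f [rs [f_mon f_irr frs zrs rs_conj]]] := min_poly_conjugates iota_alg z.
have rsO w : w \in rs -> w \in O by move=> /rs_conj[s [s_fix <-]]; apply: O_fixes.
have fO i : iota f`_i \in O.
  rewrite -coef_map; apply/polyOverP; rewrite frs big_seq rpred_prod // => w /rsO wO.
  by rewrite polyOverXsubC.
have fz : (map_poly iota f).[z] = 0 by apply/rootP; rewrite frs root_prod_XsubC.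
have : (map_poly iota f).[z ^+ q] \in nonunits O.
  rewrite -[_.[_]]subr0; apply: (@congr_trans _ O ((map_poly iota f).[z] ^+ q)); last first.
    by rewrite fz expr0n expn_eq0 eqn0Ngt prime_gt0 //= congr_refl.
  rewrite !horner_coef; apply: congr_sym => //.
  apply: congr_trans (congr_exp_sum _ _ _) _ => // [i|].
    by rewrite coef_map /= rpredM ?rpredX.
  apply: congr_sum => // i; rewrite coef_map /= exprMn exprAC.
  apply: congrM => //; rewrite ?rpredX //; first exact: residue.
  exact: congr_refl.
rewrite frs horner_prod => /nonunits_prod[w wrs|w wrs].
  by rewrite !hornerE rpredB ?rpredX ?rsO.
have [s [s_fix <-]] := rs_conj w wrs.
by rewrite !hornerE => zq_m; exists s => //; apply: congr_sym.
Qed.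

Lemma exists_primitive_root N : (0 < N)%N -> (N%:R != 0 :> E) ->
  exists z : E, N.-primitive_root z.
Proof.
move=> N_gt0 N_neq0.
have [rs rsE] := closed_field_poly_normal ('X^N - 1 : {poly E}).
have XN_mon : ('X^N - 1 : {poly E}) \is monic by rewrite -polyC1 monicXnsubC.
rewrite (monicP XN_mon) scale1r in rsE.
have szrs : size rs = N.
  by apply: succn_inj; rewrite -(size_prod_XsubC rs id) -rsE -polyC1 size_XnsubC.
have uniq_rs : uniq rs.
  rewrite -separable_prod_XsubC -rsE separable_Xn_sub_1 //.
have rs_root : all N.-unity_root rs.
  by apply/allP => z; rewrite /root_of_unity rsE root_prod_XsubC.
have /hasP[z _ z_prim] := has_prim_root N_gt0 rs_root uniq_rs (eq_leq (esym szrs)).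
by exists z.
Qed.

(** The element s is a Frobenius element at a primitive N-th root of unity z; a
    solution u is congruent to a power of z because u ^ N - 1 is the product of the
    u - z ^ i. *)
Lemma exists_frobenius_on_roots t N : (0 < N)%N -> N%:R \notin nonunits O ->
  (forall c, iota c \in O -> congr O (iota c ^+ (p ^ t)) (iota c)) ->
  exists2 s, fixes iota s &
    forall u, u \in O -> congr O (u ^+ N) 1 -> congr O (s u) (u ^+ (p ^ t)).
Proof.
move=> N_gt0 N_unit residue.
have N_neq0 : N%:R != 0 :> E by apply: contraNneq N_unit => ->; apply: nonunits0.
have [z z_prim] := exists_primitive_root N_gt0 N_neq0.
have zO : z \in O.
  have /(units_root N_gt0)/andP[] // : z ^+ N \in units O.
  by rewrite (prim_expr_order z_prim) rpred1.
have [s s_fix sz] := exists_frobenius residue zO.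
exists s => // u uO uN.
have : \prod_(i <- index_iota 0 N) (u - z ^+ i) \in nonunits O.
  have <- : ('X^N - 1).[u] = \prod_(i <- index_iota 0 N) (u - z ^+ i).
    rewrite -(factor_Xn_sub_1 z_prim) horner_prod.
    by apply: eq_bigr => i _; rewrite !hornerE.
  by rewrite !hornerE.
move=> /nonunits_prod[i _|i _ uz]; first by rewrite rpredB ?rpredX.
apply: (@congr_trans _ O (s (z ^+ i))); first exact: congr_fixes.
apply: (@congr_trans _ O ((z ^+ i) ^+ (p ^ t))).
  by rewrite rmorphXn exprAC congrX // rpredX.
by apply: congr_sym => //; apply: congrX; rewrite ?rpredX.
Qed.

Lemma coef_prod_XsubC_scale (y : E) (us : seq E) k : (k <= size us)%N ->
  (\prod_(u <- us) ('X - (y * u)%:P))`_k =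
  y ^+ (size us - k) * (\prod_(u <- us) ('X - u%:P))`_k.
Proof.
elim: us k => [|u us IHus] k; first by rewrite leqn0 => /eqP->; rewrite !big_nil mul1r.
rewrite !big_cons !mulrBl !coefB !coefXM !coefCM /=.
have out (v : E -> E) : (\prod_(w <- us) ('X - (v w)%:P))`_(size us).+1 = 0.
  by rewrite nth_default // size_prod_XsubC.
case: k => [_|k].
  by rewrite !sub0r subn0 IHus // subn0 exprS; ring.
rewrite ltnS leq_eqVlt => /orP[/eqP->|k_lt] /=.
  by rewrite !(out (fun w => _ * w)) !(out id) IHus // !subnn !mulr0 !subr0.
rewrite !IHus ?(ltnW k_lt) // subSS -(subnSK k_lt) exprS; ring.
Qed.

Lemma congr_prod_XsubC (us : seq E) k : (forall u, u \in us -> congr O u 1) ->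
  congr O (\prod_(u <- us) ('X - u%:P))`_k (('X - 1) ^+ size us)`_k.
Proof.
move=> us1.
elim: us us1 k => [|u us IHus] us1 k; first by rewrite big_nil expr0 congr_refl.
have {}IHus : forall i, congr O (\prod_(w <- us) ('X - w%:P))`_i (('X - 1) ^+ size us)`_i.
  by apply: IHus => w wus; apply: us1; rewrite inE wus orbT.
have u1 : congr O u 1 by apply: us1; rewrite mem_head.
have coefO i : (('X - 1) ^+ size us : {poly E})`_i \in O.
  by apply/polyOverP; rewrite rpredX // rpredB ?polyOverX ?rpred1.
rewrite big_cons exprS !mulrBl !coefB !coefXM coefCM mul1r.
apply: congrD => //; first by case: ifP => _; [apply: congr_refl | apply: IHus].
apply: congrN => //; rewrite -[X in congr O _ X]mul1r.
apply: congrM => //; first exact: rpred1.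
exact: congr_int (IHus _) _.
Qed.

Lemma units_coef_X_sub_1 d k : (k <= d)%N -> ~~ (p %| 'C(d, k))%N ->
  (('X - 1) ^+ d : {poly E})`_k \in units O.
Proof.
move=> kd pC; rewrite addrC exprDn coef_sum.
have kd' : (k < d.+1)%N by [].
rewrite (bigD1 (Ordinal kd')) //= big1 ?addr0 => [|i i_neq].
  rewrite coefMn -polyC1 -polyCN -polyC_exp coefCM coefXn eqxx mulr1 -mulr_natr.
  rewrite rpredM ?rpredX ?unitsN1 //.
  by rewrite inE rpred_nat /= nat_notin_nonunits.
rewrite coefMn -polyC1 -polyCN -polyC_exp coefCM coefXn.
by rewrite eq_sym (negbTE (i_neq : _ != k :> nat)) mulr0 mul0rn.
Qed.

(** If all conjugates of y are equal to y up to the principal units, the coefficient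
    of index d - p ^ a of its minimal polynomial, of degree d = p ^ a d', is
    congruent to +- 'C(d, p ^ a) y ^ (p ^ a), a unit multiple of y ^ (p ^ a). *)
Lemma tame_descent (y : E) : y != 0 ->
  (forall s, fixes iota s -> congr O (s y / y) 1) ->
  exists a c, c != 0 /\ y ^+ (p ^ a) / iota c \in units O.
Proof.
move=> y_neq0 y_fix.
have [f [rs [f_mon f_irr frs yrs rs_conj]]] := min_poly_conjugates iota_alg y.
pose us := [seq z / y | z <- rs].
have us1 u : u \in us -> congr O u 1.
  by move=> /mapP[z /rs_conj[s [s_fix <-]] ->]; apply: y_fix.
have fus : map_poly iota f = \prod_(u <- us) ('X - (y * u)%:P).
  by rewrite frs big_map; apply: eq_bigr => z _; rewrite mulrC divfK.
have d_gt0 : (0 < size us)%N by rewrite size_map; case: (rs) yrs.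
have [a [d' pd' dE]] :
    exists a, exists2 d', ~~ (p %| d')%N & size us = (p ^ a * d')%N.
  have [d' cop dE] := pfactor_coprime p_prime d_gt0.
  exists (logn p (size us)), d'; last by rewrite mulnC.
  by rewrite -prime_coprime.
have d'_gt0 : (0 < d')%N by move: d_gt0; rewrite dE muln_gt0 => /andP[].
have pa_d : (p ^ a <= size us)%N by rewrite dE leq_pmulr.
have Q_unit : (\prod_(u <- us) ('X - u%:P))`_(size us - p ^ a) \in units O.
  apply: congr_units (congr_prod_XsubC _ us1) _ => //.
  apply: units_coef_X_sub_1; first exact: leq_subr.
  by rewrite bin_sub // dE ndvdn_bin_pfactor.
have cE : iota f`_(size us - p ^ a) = y ^+ (p ^ a) *
    (\prod_(u <- us) ('X - u%:P))`_(size us - p ^ a).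
  by rewrite -coef_map fus coef_prod_XsubC_scale ?leq_subr // subKn.
exists a, f`_(size us - p ^ a); split.
  by rewrite -(fmorph_eq0 iota) cE mulf_neq0 ?expf_neq0 ?(units_neq0 Q_unit).
by rewrite -[_ / _]invrK rpredV invf_div cE mulrAC divff ?expf_neq0 // mul1r.
Qed.

(** For a Frobenius element s, the element y = x ^ q / s x satisfies the hypothesis of
    [tame_descent]: with u = t x / x, the commutation of s and t at x gives
    t y / y = u ^ q / s u, and u ^ q is congruent to s u. *)
Theorem commuting_value t N (x : E) (alpha : K) :
  (0 < N)%N -> N%:R \notin nonunits O ->
  (forall c, iota c \in O -> congr O (iota c ^+ (p ^ t)) (iota c)) ->
  x != 0 -> alpha != 0 -> congr O (x ^+ N / iota alpha) 1 ->
  (forall s s', fixes iota s -> fixes iota s' -> s (s' x) = s' (s x)) ->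
  exists a c, c != 0 /\
    iota (alpha ^+ (p ^ a * (p ^ t).-1) / c ^+ N) \in units O.
Proof.
move=> N_gt0 N_unit residue x_neq0 alpha_neq0 xN x_comm.
have [s s_fix s_frob] := exists_frobenius_on_roots N_gt0 N_unit residue.
set q := (p ^ t)%N in residue s_frob *.
have q_gt0 : (0 < q)%N by rewrite expn_gt0 prime_gt0.
have fixes_neq0 (r : {rmorphism E -> E}) : r x != 0 by rewrite fmorph_eq0.
have quot_root (r : {rmorphism E -> E}) : fixes iota r ->
    congr O ((r x / x) ^+ N) 1.
  move=> r_fix; have -> : (r x / x) ^+ N = r (x ^+ N / iota alpha) / (x ^+ N / iota alpha).
    rewrite fmorph_div rmorphXn r_fix invf_div mulrA divfK ?fmorph_eq0 //.
    by rewrite expr_div_n.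
  apply: congr1_divr => //; rewrite -(rmorph1 r); exact: congr_fixes.
have quot_unit (r : {rmorphism E -> E}) : fixes iota r -> r x / x \in units O.
  by move=> /quot_root/congr1_units/(units_root N_gt0); apply.
pose y := x ^+ q / s x.
have y_neq0 : y != 0 by rewrite mulf_neq0 ?expf_neq0 ?invr_eq0.
have [r r_fix|a [c [c_neq0 yc]]] := tame_descent y_neq0.
  set u := r x / x.
  have su_unit : s u \in units O.
    apply: (congr_units (s_frob u _ (quot_root _ r_fix))).
      by case/andP: (quot_unit r r_fix).
    by rewrite rpredX ?quot_unit.
  have -> : r y / y = u ^+ q / s u.
    rewrite /y /u !fmorph_div rmorphXn (x_comm r s) // !invf_div expr_div_n.
    rewrite -!mulrA; congr (_ * _); rewrite mulrCA [RHS]mulrCA.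
    by congr (_ * _); rewrite mulrC.
  move: (su_unit); rewrite unitsE => /and3P[su_neq0 suO suVO].
  rewrite /congr -(divff su_neq0) -mulrBl mulrC nonunitsM //.
  apply: congr_sym => //; apply: s_frob (quot_root _ r_fix).
  by case/andP: (quot_unit r r_fix).
exists a, c; split=> //.
have ic_neq0 : iota c != 0 by rewrite fmorph_eq0.
have w_unit := quot_unit s s_fix; set w := s x / x in w_unit.
have yE : y = x ^+ q.-1 / w by rewrite /y /w invf_div mulrA -exprSr prednK.
clearbody w.
have -> : iota (alpha ^+ (p ^ a * q.-1) / c ^+ N) =
    (y ^+ (p ^ a) / iota c) ^+ N * w ^+ (p ^ a * N) /
    (x ^+ N / iota alpha) ^+ (p ^ a * q.-1).
  have XE : x ^+ q.-1 ^+ (p ^ a) ^+ N = x ^+ N ^+ (p ^ a * q.-1).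
    by rewrite -!exprM; congr (_ ^+ _); rewrite -?mulnA [LHS]mulnC -mulnA mulnCA.
  rewrite yE fmorph_div !rmorphXn !expr_div_n XE -(exprM w).
  have X_neq0 : x ^+ N ^+ (p ^ a * q.-1) != 0 by rewrite !expf_neq0.
  have W_neq0 : w ^+ (p ^ a * N) != 0 by rewrite expf_neq0 ?(units_neq0 w_unit).
  have A_neq0 : iota alpha ^+ (p ^ a * q.-1) != 0 by rewrite expf_neq0 ?fmorph_eq0.
  have C_neq0 : iota c ^+ N != 0 by rewrite expf_neq0.
  have cancel_powers (A C X W : E) : A != 0 -> C != 0 -> X != 0 -> W != 0 ->
      A / C = X / W / C * W / (X / A).
    by move=> A0 C0 X0 W0; field; rewrite A0 C0 X0.
  exact: cancel_powers.
rewrite rpred_div ?rpredM ?rpredX ?w_unit //.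
exact: congr1_units.
Qed.

End Tame.

(** * Bounded-degree extensions of a complete field *)

(** K is an extension of degree bounded by D of a complete field B with values in the
    powers of r and residue field contained in the field with p ^ s elements. *)
Record finite_over_local (R : realType) (B K : fieldType) (vB : B -> R)
    (v : K -> R) (j : {rmorphism B -> K}) (p s D : nat) (r : R) : Prop := {
  base_abs : nonarch_abs vB;
  base_complete : abs_complete vB;
  base_residue : forall b, vB b <= 1 -> vB (b ^+ (p ^ s) - b) < 1;
  base_discrete : forall b, b != 0 -> exists n : int, vB b = r ^ n;
  residue_prime : prime p;
  residue_degree : (0 < s)%N;
  residue_char : vB p%:R < 1;
  uniformizer : 0 < r < 1;
  top_abs : nonarch_abs v;
  top_extends : forall b, v (j b) = vB b;
  bounded_degree : forall x : K, exists P : {poly B},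
    [/\ P != 0, (size P <= D.+1)%N & root (map_poly j P) x] }.

Section LocalArithmetic.
Variables (R : realType) (B K : fieldType) (vB : B -> R) (v : K -> R).
Variables (j : {rmorphism B -> K}) (p s D : nat) (r : R).
Hypothesis K_local : finite_over_local vB v j p s D r.
Variables (E : closedFieldType) (iota : {rmorphism K -> E}).
Hypothesis iota_alg : algebraic_closure iota.

Let vB_abs := base_abs K_local.
Let v_abs := top_abs K_local.
Let jE : {rmorphism B -> E} := iota \o j.

Lemma base_algebraic : algebraic_closure jE.
Proof.
move=> z; have [P P_neq0 Pz] := iota_alg z.
apply/integral_algebraic; apply: (@integral_root _ _ jE (map_poly iota P)) => //.
  by rewrite map_poly_eq0.
apply/integral_poly => i; rewrite coef_map; apply/integral_algebraic.
have [Q [Q_neq0 _ Qi]] := bounded_degree K_local P`_i.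
exists Q => //; have -> : map_poly jE Q = map_poly iota (map_poly j Q).
  by rewrite -map_poly_comp.
by rewrite fmorph_root.
Qed.

Definition closure_integers : valuation_subring E :=
  integral_closure_valuation vB_abs (base_complete K_local) base_algebraic.
Let O := closure_integers.

Lemma closure_integers_fixes (t : {rmorphism E -> E}) x :
  fixes iota t -> x \in O -> t x \in O.
Proof. by move=> t_fix; apply: integral_closure_fixes => b; apply: t_fix. Qed.

Let integral_le1 c : iota c \in O -> v c <= 1.
Proof.
move=> /asboolP[P [P_mon PO]].
have -> : map_poly jE P = map_poly iota (map_poly j P) by rewrite -map_poly_comp.
rewrite fmorph_root => Pc.
exact: (integral_abs_le1 vB_abs v_abs (top_extends K_local) P_mon PO Pc).
Qed.

Let units_eq1 c : iota c \in units O -> v c = 1.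
Proof.
rewrite unitsE fmorph_eq0 -fmorphV => /and3P[c0 /integral_le1 c1 /integral_le1].
rewrite (absV v_abs) invf_le1 ?(abs_gt0 v_abs) // => c1'.
by apply/eqP; rewrite eq_le c1.
Qed.

(** Up to a unit, a power of c lies in B; this determines v c, and transfers to K what
    is known of the values of B. *)
Lemma power_in_base (c : K) : c != 0 -> exists (d : nat) (b : B),
  [/\ (0 < d <= D)%N, b != 0, v c ^+ d = vB b & iota c ^+ d / jE b \in units O].
Proof.
move=> c_neq0; have [P [P_neq0 szP Pc]] := bounded_degree K_local c.
have Pic : root (map_poly jE P) (iota c).
  have -> : map_poly jE P = map_poly iota (map_poly j P) by rewrite -map_poly_comp.
  by rewrite fmorph_root.
have ic_neq0 : iota c != 0 by rewrite fmorph_eq0.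
have [d [b [d_gt0 d_lt b_neq0 u]]] :=
  power_over_base vB_abs (base_complete K_local) base_algebraic P_neq0 Pic ic_neq0.
exists d, b; split=> //.
  by rewrite d_gt0 -ltnS (leq_trans d_lt szP).
have : v (c ^+ d / j b) = 1 by apply: units_eq1; rewrite fmorph_div rmorphXn.
rewrite (absM v_abs) (absV v_abs) (absX v_abs) (top_extends K_local) => /(canRL (divfK _)) ->.
  by rewrite mul1r.
by rewrite gt_eqF // (abs_gt0 vB_abs).
Qed.

Lemma closure_integersE c : (iota c \in O) = (v c <= 1).
Proof.
apply/idP/idP => [|c1]; first exact: integral_le1.
have [->|c_neq0] := eqVneq c 0; first by rewrite rmorph0 rpred0.
have [d [b [/andP[d_gt0 _] b_neq0 vcd u]]] := power_in_base c_neq0.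
apply: (@valuation_root _ _ d) => //.
have jb_neq0 : jE b != 0 by rewrite fmorph_eq0.
rewrite -(divfK jb_neq0 (iota c ^+ d)) rpredM //; first by case/andP: u.
rewrite -[_ \in O]/(jE b \in integral_closure vB jE) (integral_closure_base vB_abs).
by rewrite -vcd exprn_ile1 // (abs_ge0 v_abs).
Qed.

Lemma closure_nonunitsE c : (iota c \in nonunits O) = (v c < 1).
Proof.
have [->|c_neq0] := eqVneq c 0; first by rewrite rmorph0 nonunits0 (abs0 v_abs) ltr01.
rewrite nonunitsP ?fmorph_eq0 // -fmorphV closure_integersE (absV v_abs).
by rewrite invf_le1 ?(abs_gt0 v_abs) // ltNge.
Qed.

Lemma closure_unitsE c : (iota c \in units O) = (v c == 1).
Proof. by rewrite inE closure_integersE closure_nonunitsE -leNgt eq_le. Qed.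

Lemma discrete_power c : c != 0 -> exists n : int, v c ^+ D`! = r ^ n.
Proof.
move=> c_neq0; have [d [b [/andP[d_gt0 dD] b_neq0 vcd _]]] := power_in_base c_neq0.
have [n bn] := base_discrete K_local b_neq0.
have /dvdnP[k ->] : (d %| D`!)%N by rewrite dvdn_fact // d_gt0.
by exists (n * k%:Z); rewrite mulnC exprM vcd bn; apply: (exprz_exp r n k).
Qed.

Lemma residue_char_nonunit : p%:R \in nonunits O.
Proof.
rewrite -(rmorph_nat iota) closure_nonunitsE -(rmorph_nat j).
by rewrite (top_extends K_local) (residue_char K_local).
Qed.

(** The residue of c has degree at most D over the residue field of B, so it is
    fixed by some power of the Frobenius map of exponent at most D. *)
Lemma residue_power c :
  iota c \in O -> congr O (iota c ^+ (p ^ (s * D`!))) (iota c).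
Proof.
set x := iota c => xO.
have p_prime := residue_prime K_local.
have p_m := residue_char_nonunit.
have O_fixesB (t : {rmorphism E -> E}) y : fixes jE t -> y \in O -> t y \in O.
  exact: integral_closure_fixes.
have residueB b : jE b \in O -> congr O (jE b ^+ (p ^ s)) (jE b).
  rewrite closure_integersE (top_extends K_local) => /(base_residue K_local).
  by rewrite /congr -rmorphXn -rmorphB closure_nonunitsE (top_extends K_local).
have frob z : z \in O -> exists2 t, fixes jE t & congr O (t z) (z ^+ (p ^ s)).
  exact: (exists_frobenius base_algebraic O_fixesB p_prime p_m residueB).
have [f [rs [f_mon f_irr frs xrs rs_conj]]] := min_poly_conjugates base_algebraic x.
have szrs : (size rs <= D)%N.
  have [P [P_neq0 szP Pc]] := bounded_degree K_local c.
  rewrite -ltnS (leq_trans _ szP) // -(size_prod_XsubC rs id) -frs size_map_poly.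
  apply: dvdp_leq => //; apply: (irreducible_root_dvd f_irr (iota := jE) (x := x)).
    by rewrite frs root_prod_XsubC.
  have -> : map_poly jE P = map_poly iota (map_poly j P) by rewrite -map_poly_comp.
  by rewrite fmorph_root.
have rsO w : w \in rs -> w \in O by move=> /rs_conj[t [t_fix <-]]; apply: O_fixesB.
have pow_conj i : exists w, w \in rs /\ congr O (x ^+ (p ^ (s * i))) w.
  elim: i => [|i [w [wrs xw]]]; first by exists x; rewrite muln0 expr1 congr_refl.
  have [t t_fix tw] := frob w (rsO w wrs).
  exists (t w); split.
    by rewrite -root_prod_XsubC -frs fixes_root // frs root_prod_XsubC.
  rewrite mulnS addnC expnD exprM; apply: congr_trans (congr_sym tw).
  by apply: congrX => //; apply: rsO.
pose w i := sval (cid (pow_conj i)).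
have w_rs i : w i \in rs by have [] := svalP (cid (pow_conj i)).
have w_congr i : congr O (x ^+ (p ^ (s * i))) (w i) by have [] := svalP (cid (pow_conj i)).
(* Pigeonhole: the powers x ^ (Q ^ i), Q = p ^ s, are congruent to conjugates of x. *)
have [i [k [k_gt0 kD ik]]] : exists i k, [/\ (0 < k)%N, (k <= D)%N & w (i + k)%N = w i].
  have : ~~ uniq (mkseq w (size rs).+1).
    apply/negP => w_uniq; have : (size (mkseq w (size rs).+1) <= size rs)%N.
      by apply: uniq_leq_size w_uniq _ => _ /mapP[i _ ->].
    by rewrite size_mkseq ltnn.
  move=> /(uniqPn x)[i [i' [ii']]]; rewrite size_mkseq => i'_le.
  rewrite !nth_mkseq // ?(ltn_trans ii') // => wE.
  exists i, (i' - i)%N; rewrite subn_gt0 ii' subnKC ?(ltnW ii') //; split=> //.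
  by rewrite (leq_trans (leq_subr _ _)) // (leq_trans _ szrs).
have xk : congr O (x ^+ (p ^ (s * k))) x.
  set a := x ^+ _; have aO : a \in O by rewrite rpredX.
  apply: (@nonunits_exp _ _ _ (p ^ (s * i))); first by rewrite rpredB.
  have axO : a - x \in O by rewrite rpredB.
  have := congr_expD_pfactor p_prime p_m (s * i) axO xO.
  rewrite subrK -exprM -expnD -mulnDr addnC => frob_sum.
  have eq_pow : congr O (x ^+ (p ^ (s * (i + k)))) (x ^+ (p ^ (s * i))).
    by apply: congr_trans (w_congr _) _; rewrite ik; apply: congr_sym.
  have := congr_trans (congr_sym frob_sum) eq_pow.
  by rewrite /congr addrK.
have /dvdnP[e ->] : (k %| D`!)%N by rewrite dvdn_fact // k_gt0.
elim: e => [|e IHe]; first by rewrite mul0n muln0 expr1 congr_refl.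
rewrite mulSn mulnDr expnD exprM; apply: congr_trans IHe.
exact: congrX.
Qed.

End LocalArithmetic.

(** * Local fields *)

Section PadicField.
Variables (R : realType) (c : R) (p : nat) (Qp : fieldType) (v : Qp -> R).
Hypotheses (p_prime : prime p) (c01 : 0 < c < 1) (Qp_padic : is_padic_field c p v).

Let v_abs : nonarch_abs v := padic_nonarch Qp_padic.

Lemma padic_abs_int (z : int) : v z%:~R = if z == 0 then 0 else c ^+ logn p `|z|.
Proof.
rewrite -(ratr_int Qp) (padic_extends Qp_padic) /padic_abs intr_eq0.
by case: eqP => // _; rewrite numq_int denq_int logn1 subr0.
Qed.

Lemma padic_int_neq0 (z : int) : z != 0 -> z%:~R != 0 :> Qp.
Proof.
move=> z_neq0; apply/eqP => z0; have := padic_abs_int z.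
rewrite z0 (abs0 v_abs) (negbTE z_neq0) => /esym/eqP.
by case/andP: c01 => c0 _; rewrite expf_eq0 (gt_eqF c0) andbF.
Qed.

Lemma padic_abs_rat (x : rat) : v (ratr x) = v (numq x)%:~R / v (denq x)%:~R.
Proof. by rewrite (absM v_abs) (absV v_abs). Qed.

Lemma padic_int_lt1 (z : int) : (p %| `|z|)%N -> v z%:~R < 1.
Proof.
case/andP: c01 => c0 c1; rewrite padic_abs_int; case: eqP => [_|/eqP z0] pz //.
rewrite exprn_ilt1 // ?ltW // -lt0n logn_gt0 mem_primes p_prime pz andbT.
by rewrite lt0n absz_eq0.
Qed.

Lemma padic_int_eq1 (z : int) : ~~ (p %| `|z|)%N -> v z%:~R = 1.
Proof.
rewrite padic_abs_int; case: eqP => [->|_] pz; first by rewrite dvdn0 in pz.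
by rewrite logn_coprime ?expr0 // prime_coprime.
Qed.

Lemma padic_denq (x : rat) : v (ratr x) <= 1 -> ~~ (p %| `|denq x|)%N.
Proof.
move=> x1; apply/negP => p_den.
have p_num : ~~ (p %| `|numq x|)%N.
  apply/negP => p_num; have : (p %| 1)%N by rewrite -(eqP (coprime_num_den x)) dvdn_gcd p_num.
  by rewrite dvdn1 => /eqP p1; move: p_prime; rewrite p1.
move: x1; rewrite padic_abs_rat (padic_int_eq1 p_num) mul1r invf_le1.
  by rewrite leNgt padic_int_lt1.
by rewrite (abs_gt0 v_abs) // padic_int_neq0 // denq_neq0.
Qed.

(** Fermat's little theorem, applied to the numerator and the denominator. *)
Lemma padic_residue_rat (x : rat) : v (ratr x) <= 1 -> v (ratr x ^+ p - ratr x) < 1.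
Proof.
move=> /padic_denq p_den; pose a := numq x; pose d := denq x.
have vd : v d%:~R = 1 by apply: padic_int_eq1.
have d_neq0 : d%:~R != 0 :> Qp.
  by apply/eqP => d0; move: vd; rewrite d0 (abs0 v_abs) => /eqP; rewrite eq_sym oner_eq0.
have -> : ratr x ^+ p - ratr x = (a ^+ p * d - a * d ^+ p)%:~R / d%:~R ^+ p.+1 :> Qp.
  rewrite /ratr -/a -/d rmorphB !rmorphM /= !rmorphXn /= expr_div_n exprS.
  by field; rewrite d_neq0 expf_neq0.
rewrite (absM v_abs) (absV v_abs) (absX v_abs) vd expr1n invr1 mulr1.
apply: padic_int_lt1.
have fermat (z : int) : (z%:~R : 'F_p) ^+ p = z%:~R.
  by have := expf_card (z%:~R : 'F_p); rewrite (card_Fp p_prime).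
have int0 : (a ^+ p * d - a * d ^+ p)%:~R = 0 :> 'F_p.
  by rewrite rmorphB !rmorphM /= !rmorphXn /= !fermat subrr.
rewrite (dvdn_pcharf (pchar_Fp p_prime)).
move: int0; set z := _ - _; case: (intP z) => [|n|n] //=; first by move=> /eqP.
by rewrite mulrNz => /eqP; rewrite oppr_eq0.
Qed.

Lemma padic_residue b : v b <= 1 -> v (b ^+ p - b) < 1.
Proof.
move=> b1; have [x bx] := padic_dense Qp_padic b ltr01.
have x1 : v (ratr x) <= 1.
  by rewrite -(subKr b (ratr x)) (absB_le v_abs) // ltW.
have bxp : v (b ^+ p - ratr x ^+ p) < 1.
  rewrite subrXX (absM v_abs); apply: le_lt_trans bx.
  rewrite ler_piMr ?(abs_ge0 v_abs) // (abs_sum_le v_abs) // => i _.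
  rewrite (absM v_abs) !(absX v_abs).
  by rewrite mulr_ile1 ?exprn_ge0 ?(abs_ge0 v_abs) ?exprn_ile1 ?(abs_ge0 v_abs).
have xxp := padic_residue_rat x1.
have -> : b ^+ p - b =
    (b ^+ p - ratr x ^+ p) + ((ratr x ^+ p - ratr x) - (b - ratr x)) by ring.
rewrite (le_lt_trans (absD v_abs _ _)) // gt_max bxp /=.
by rewrite (le_lt_trans (absD v_abs _ _)) // gt_max xxp (absN v_abs).
Qed.

(** By density b has the absolute value of a rational number. *)
Lemma padic_discrete b : b != 0 -> exists n : int, v b = c ^ n.
Proof.
move=> b_neq0; have b_gt0 := abs_gt0 v_abs b_neq0.
have [x bx] := padic_dense Qp_padic b b_gt0.
have vbx : v b = v (ratr x).
  apply/eqP; rewrite eq_le; apply/andP; split.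
    rewrite leNgt; apply/negP => lt_x.
    have := absD v_abs (b - ratr x) (ratr x); rewrite subrK leNgt gt_max bx lt_x //.
  by rewrite -(subKr b (ratr x)) (absB_le v_abs) // ltW.
have x_neq0 : x != 0.
  apply: contraTneq b_gt0 => x0; rewrite vbx x0 (padic_extends Qp_padic) /padic_abs eqxx.
  by rewrite ltxx.
rewrite vbx (padic_extends Qp_padic) /padic_abs (negbTE x_neq0).
by eexists.
Qed.

Lemma padic_finite_over_local (K : fieldType) (w : K -> R) (L : fieldExtType Qp)
    (f : {rmorphism L -> K}) :
  bijective f -> nonarch_abs w -> (forall a : Qp, w (f a%:A) = v a) ->
  finite_over_local v w (f \o GRing.in_alg L) p 1 (\dim {:L}) c.
Proof.
move=> [g fK gK] w_abs wE; split=> //.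
- exact: padic_complete Qp_padic.
- by move=> b; rewrite expn1; apply: padic_residue.
- exact: padic_discrete.
- by rewrite pmulrn; apply: padic_int_lt1.
move=> x; pose y := g x.
have /polyOver1P[q qE] : minPoly 1%AS y \is a polyOver 1%AS by apply: minPolyOver.
exists q; split.
- by rewrite -(map_poly_eq0 (GRing.in_alg L)) -qE monic_neq0 // monic_minPoly.
- rewrite -(size_map_poly (GRing.in_alg L)) -qE size_minPoly ltnS.
  have := dim_Fadjoin 1%AS y; rewrite dimv1 muln1 => <-.
  by rewrite dimvS // subvf.
- have -> : map_poly (f \o GRing.in_alg L) q = map_poly f (map_poly (GRing.in_alg L) q).
    by rewrite -map_poly_comp.
  by rewrite -qE -(gK x) fmorph_root root_minPoly.
Qed.

End PadicField.

Section LaurentField.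
Variables (R : realType) (K : fieldType) (v : K -> R) (Fq : finFieldType) (c : R).
Variable f : K -> int -> Fq.
Hypotheses (c01 : 0 < c < 1) (f_bij : set_bij [set: K]%classic (@laurent_series Fq) f).
Hypothesis fD : forall x y n, f (x + y) n = f x n + f y n.
Hypothesis fM : forall x y, f (x * y) = laurent_mul (f x) (f y).
Hypothesis v0 : v 0 = 0.
Hypothesis v_order : forall x n, (forall m, m < n -> f x m = 0) -> f x n != 0 -> v x = c ^ n.

Let below x n := forall m : int, m < n -> f x m = 0.

Let c_gt0 : 0 < c. Proof. by case/andP: c01. Qed.
Let c_lt1 : c < 1. Proof. by case/andP: c01. Qed.

Let c_le k n : (c ^ k <= c ^ n) = (n <= k).
Proof. by rewrite -[c]invrK !(exprz_inv c^-1) ler_eXz2l ?invf_gt1 // lerN2. Qed.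

Let f0 n : f 0 n = 0.
Proof. by apply: (addrI (f 0 n)); rewrite -fD !addr0. Qed.

Let fB x y n : f (x - y) n = f x n - f y n.
Proof. by apply: (addIr (f y n)); rewrite -fD !subrK. Qed.

Let f_inj x y : (forall n, f x n = f y n) -> x = y.
Proof.
move=> fxy; have [_ inj _] := f_bij.
by apply: inj; rewrite ?in_setT //; apply/funext.
Qed.

Let support x : exists N : int, below x N.
Proof. by have [/(_ x I) [N xN] _ _] := f_bij; exists N. Qed.

Let order x : x != 0 -> exists n, below x n /\ f x n != 0.
Proof.
move=> x_neq0; have [N xN] := support x.
have [k fxk] : exists k, f x k != 0.
  apply: contrapT => /forallNP all0; move/eqP: x_neq0; apply.
  by apply: f_inj => n; rewrite f0; apply/eqP; apply: contraT => /all0.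
have Nk : N <= k by rewrite leNgt; apply/negP => /xN fk; rewrite fk eqxx in fxk.
have shift m : N <= m -> N + `|m - N|%N%:Z = m.
  by move=> Nm; rewrite gez0_abs ?subr_ge0 // addrCA subrr addr0.
have exi : exists i : nat, f x (N + i%:Z) != 0.
  by exists `|k - N|%N; rewrite shift.
case: (ex_minnP exi) => i fxi min_i; exists (N + i%:Z); split=> // m m_lt.
have [/xN//|Nm] := ltP m N; apply/eqP; apply: contraT => fm.
have := min_i `|m - N|%N; rewrite shift // => /(_ fm).
rewrite leqNgt => /negP[]; rewrite -ltz_nat gez0_abs ?subr_ge0 //.
by rewrite ltrBlDl.
Qed.

Let v_leE x n : v x <= c ^ n <-> below x n.
Proof.
have [->|/order[k [xk fxk]]] := eqVneq x 0.
  by rewrite v0; split=> _ => [m _|]; rewrite ?f0 // ltW // exprz_gt0.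
rewrite (v_order xk fxk) c_le.
split=> [nk m mn|xn]; first by apply: xk; apply: lt_le_trans nk.
by rewrite leNgt; apply/negP => /xn fk; rewrite fk eqxx in fxk.
Qed.

Let laurent_mul_below x y n m : below x n -> below y m -> below (x * y) (n + m).
Proof.
move=> xn ym k k_lt; rewrite fM; apply: fsbig1 => i _.
have [/xn->|ni] := ltP i n; first by rewrite mul0r.
rewrite ym ?mulr0 // ltrBlDr (lt_le_trans k_lt) // addrC lerD2l //.
Qed.

Let laurent_mul_lead x y n m : below x n -> below y m ->
  f (x * y) (n + m) = f x n * f y m.
Proof.
move=> xn ym; rewrite fM /laurent_mul (fsbigE [:: n]) //=; first last.
  move=> i _; rewrite inE => i_neq; have [/xn->|ni] := ltP i n; first by rewrite mul0r.
  rewrite ym ?mulr0 // ltrBlDr addrC ltrD2l lt_neqAle ni andbT eq_sym //.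
by rewrite big_cons big_nil in_setT addr0 addrAC subrr add0r.
Qed.

Lemma laurent_nonarch : nonarch_abs v.
Proof.
have v_gt0 x : x != 0 -> 0 < v x.
  by move=> /order[n [xn fxn]]; rewrite (v_order xn fxn) exprz_gt0.
split.
- by move=> x; have [->|/v_gt0/ltW//] := eqVneq x 0; rewrite v0.
- move=> x; split=> [vx|->//]; apply/eqP; apply: contraT => /v_gt0.
  by rewrite vx ltxx.
- move=> x y; have [->|x0] := eqVneq x 0; first by rewrite mul0r v0 mul0r.
  have [->|y0] := eqVneq y 0; first by rewrite mulr0 v0 mulr0.
  have [n [xn fxn]] := order x0; have [m [ym fym]] := order y0.
  rewrite (v_order xn fxn) (v_order ym fym) -exprzDr ?unitfE ?gt_eqF //.
    apply: v_order; first exact: laurent_mul_below.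
    by rewrite laurent_mul_lead // mulf_neq0.
- move=> x y; have [->|x0] := eqVneq x 0; first by rewrite add0r v0 le_max lexx orbT.
  have [->|y0] := eqVneq y 0; first by rewrite addr0 v0 le_max lexx.
  have [k vk] : exists k, Num.max (v x) (v y) = c ^ k.
    have [n [xn fxn]] := order x0; have [m [ym fym]] := order y0.
    rewrite (v_order xn fxn) (v_order ym fym).
    by case: (leP (c ^ n) (c ^ m)) => _; eexists.
  rewrite vk; apply/v_leE => i ik; rewrite fD.
  have /v_leE -> // : v x <= c ^ k by rewrite -vk le_max lexx.
  have /v_leE -> // : v y <= c ^ k by rewrite -vk le_max lexx orbT.
  by rewrite addr0.
Qed.

Let small_power (eps : R) : 0 < eps -> exists k : nat, c ^ k%:Z < eps.
Proof. by apply: geometric_small; rewrite ltW. Qed.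

(** Each coefficient of a Cauchy sequence is eventually constant. *)
Lemma laurent_complete : abs_complete v.
Proof.
move=> u u_cauchy.
have coef_stable (n : int) : exists N, forall a b, (N <= a)%N -> (N <= b)%N ->
    below (u a - u b) n.
  have [N uN] := u_cauchy _ (exprz_gt0 n c_gt0).
  by exists N => a b Na Nb; apply/v_leE/ltW/uN.
pose N n := sval (cid (coef_stable n)).
have NP n a b : (N n <= a)%N -> (N n <= b)%N -> forall m, m < n -> f (u a) m = f (u b) m.
  move=> Na Nb m mn; apply/eqP; rewrite -subr_eq0 -fB.
  by rewrite (svalP (cid (coef_stable n))).
pose a n := f (u (N (n + 1))) n.
have aE n k m : (N n <= k)%N -> m < n -> f (u k) m = a m.
  move=> Nk mn; transitivity (f (u (maxn k (N (m + 1)))) m).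
    by apply: (NP n) => //; rewrite leq_max Nk.
  by apply: (NP (m + 1)); rewrite ?leq_maxr // ltrDl.
have a_laurent : laurent_series a.
  have [M uM] := support (u (N 0)); exists (Num.min M 0) => n.
  rewrite lt_min => /andP[nM n0]; rewrite -(aE 0 (N 0)) //.
  exact: uM.
have [_ _ /(_ a a_laurent)[l _ la]] := f_bij.
exists l => eps /small_power[k k_eps]; exists (N k) => n Nn.
apply: le_lt_trans k_eps; apply/v_leE => m mk.
by rewrite fB la (aE k) ?subrr.
Qed.

Let residue_pow b n : below b 0 -> below (b ^+ n.+1) 0 /\ f (b ^+ n.+1) 0 = f b 0 ^+ n.+1.
Proof.
move=> b0; elim: n => [|n [bn fbn]]; first by rewrite expr1.
split; first by rewrite exprS -(addr0 0); apply: laurent_mul_below.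
by rewrite exprS -[X in f _ X](addr0 0) laurent_mul_lead // fbn -exprS.
Qed.

(** On integral series, b |-> f b 0 is multiplicative with values in Fq, whose elements
    satisfy x ^ #|Fq| = x. *)
Lemma laurent_finite_over_local :
  exists p s, finite_over_local v v (idfun : {rmorphism K -> K}) p s 1 c.
Proof.
have [p p_prime p_char] := finPcharP Fq.
pose s := logn p #|Fq|.
have cardFq : #|Fq| = (p ^ s)%N by exact: (card_pprimeChar p_char).
have s_gt0 : (0 < s)%N.
  by rewrite lt0n; apply: contraTneq (finNzRing_gt1 Fq) => s0; rewrite cardFq s0.
exists p, s; split=> //; first exact: laurent_nonarch.
- exact: laurent_complete.
- move=> b b1; apply: le_lt_trans c_lt1; rewrite -[c in _ <= c](expr1z c).
  have b0 : below b 0 by apply/v_leE; rewrite expr0z.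
  have q_gt0 : (0 < p ^ s)%N by rewrite expn_gt0 prime_gt0.
  have [bq fbq] := residue_pow (p ^ s).-1 b0; rewrite prednK // in bq fbq.
  apply/v_leE => m; rewrite -[1]add0r ltzD1 le_eqVlt fB => /orP[/eqP->|m0].
    by rewrite fbq -cardFq expf_card subrr.
  by rewrite bq // b0 // subrr.
- by move=> b /order[n [bn fbn]]; exists n; apply: v_order.
- have -> : p%:R = 0 :> K; last by rewrite v0 ltr01.
  apply: f_inj => n; rewrite f0.
  have fMn k x : f (x *+ k) n = f x n *+ k.
    by elim: k => [|k IHk]; rewrite ?mulr0n ?f0 // !mulrS fD IHk.
  by rewrite fMn -mulr_natr (pcharf0 p_char) mulr0.
- exact: laurent_nonarch.
- move=> x; exists ('X - x%:P); split; first by rewrite polyXsubC_eq0.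
    by rewrite size_XsubC.
  by rewrite map_polyXsubC root_XsubC.
Qed.

End LaurentField.

(** * Large preimages and the Galois group of K_infty *)

Section LargePreimages.
Variables (E : closedFieldType) (O : valuation_subring E).

Lemma large_horner (f : {poly E}) x : f \is monic -> f \is a polyOver O -> x \notin O ->
  congr O (f.[x] / x ^+ (size f).-1) 1.
Proof.
move=> f_mon /polyOverP fO /notin_val[x_neq0 xV].
have [d szf] : exists d, size f = d.+1.
  by exists (size f).-1; rewrite prednK // size_poly_gt0 monic_neq0.
rewrite horner_coef szf big_ord_recr /= mulrDl -[d in f`_d]/(d.+1.-1) -szf -/(lead_coef f).
rewrite (monicP f_mon) mul1r divff ?expf_neq0 // /congr addrK big_distrl /=.
rewrite rpred_sum // => i _; rewrite -mulrA nonunitsM //.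
have -> : x ^+ i / x ^+ d = x^-1 ^+ (d - i).
  rewrite exprVn; apply: (canLR (mulfK (expf_neq0 d x_neq0))).
  have -> : x ^+ d = x ^+ (d - i) * x ^+ i by rewrite -exprD subnK // ltnW.
  by rewrite mulKf ?expf_neq0.
have : (0 < d - i)%N by rewrite subn_gt0.
case: (d - i)%N => // n _; rewrite exprS nonunitsMr // rpredX //.
exact: nonunits_sub.
Qed.

(** The roots of f1 - z f2 cannot all be integral, since its coefficient of index
    deg f2 is z up to an integral term. *)
Lemma large_preimage (f1 f2 : {poly E}) (e : nat) (z : E) :
  f1 \is monic -> f1 \is a polyOver O -> f2 \is monic -> f2 \is a polyOver O ->
  (0 < e)%N -> (size f1).-1 = ((size f2).-1 + e)%N -> z \notin O ->
  exists x, [/\ x \notin O, f2.[x] != 0, f1.[x] / f2.[x] = z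
    & congr O (x ^+ e / z) 1].
Proof.
move=> f1_mon f1O f2_mon f2O e_gt0 deg_e zO.
have [z_neq0 _] := notin_val zO.
have f1_gt0 : (0 < size f1)%N by rewrite size_poly_gt0 monic_neq0.
have f2_gt0 : (0 < size f2)%N by rewrite size_poly_gt0 monic_neq0.
have sz_lt : (size (z *: f2) < size f1)%N.
  rewrite (leq_ltn_trans (size_scale_leq _ _)) // -(prednK f1_gt0) -(prednK f2_gt0).
  by rewrite deg_e ltnS -addn1 leq_add2l.
have P_mon : f1 - z *: f2 \is monic.
  by rewrite monicE lead_coefDl ?size_polyN // -monicE.
have [rs P_rs] := closed_field_poly_normal (f1 - z *: f2).
rewrite (monicP P_mon) scale1r in P_rs.
have [x xrs xO] : exists2 x, x \in rs & x \notin O.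
  apply/hasP; apply: contraNT zO => /hasPn rsO.
  have PO : f1 - z *: f2 \is a polyOver O.
    rewrite P_rs big_seq rpred_prod // => x /rsO; rewrite negbK => xO.
    by rewrite polyOverXsubC.
  have := polyOverP PO (size f2).-1.
  rewrite coefB coefZ -/(lead_coef f2) (monicP f2_mon) mulr1.
  by rewrite rpredBl // (polyOverP f1O).
have := root_prod_XsubC rs x; rewrite xrs -P_rs /root !hornerE subr_eq0 => /eqP f1x.
have [x_neq0 _] := notin_val xO.
have a1 := large_horner f1_mon f1O xO; have b1 := large_horner f2_mon f2O xO.
have a_neq0 := units_neq0 (congr1_units a1); have b_neq0 := units_neq0 (congr1_units b1).
have f2x_neq0 : f2.[x] != 0 by apply: contraNneq b_neq0 => ->; rewrite mul0r.
exists x; split=> //; first by rewrite f1x mulfK.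
suff -> : x ^+ e / z = (f2.[x] / x ^+ (size f2).-1) / (f1.[x] / x ^+ (size f1).-1).
  exact: congr1_divr.
rewrite f1x deg_e exprD; field.
by rewrite f2x_neq0 z_neq0 !expf_neq0.
Qed.

End LargePreimages.

Section GaloisOfKInfty.
Variables (K : fieldType) (E : closedFieldType) (iota : {rmorphism K -> E}).
Hypothesis iota_alg : algebraic_closure iota.
Variables (phi : {fraction {poly K}}) (alpha : K).

Lemma fixes_iter_value (s : {rmorphism E -> E}) n x y :
  fixes iota s -> iter_value iota phi n x y -> iter_value iota phi n (s x) (s y).
Proof.
move=> s_fix; elim: n x => [|n IHn] x /=; first by move->.
move=> [z [g [h [phiE hx zE]]] zy]; exists (s z); last exact: IHn.
exists g, h; split=> //; rewrite -!fixes_horner //; first by rewrite fmorph_eq0.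
by rewrite zE fmorph_div.
Qed.

(** The elements that s maps into a subfield S form a subfield, and it contains the
    generators if S does, because s maps generators to generators. *)
Lemma fixes_generated (s : {rmorphism E -> E}) x : fixes iota s ->
  generated_pred (K_infty_generators iota phi alpha) x ->
  generated_pred (K_infty_generators iota phi alpha) (s x).
Proof.
move=> s_fix /asboolP x_gen; apply/asboolP => S [S_div S_gen].
have memP (U : set E) z : (z \in [pred w in U]) = (z \in U) by [].
apply: (x_gen [set w | S (s w)]%classic); split.
  have [S1 SB SD] := S_div.
  split=> [|w z|w z]; rewrite ?memP.
  - by apply/mem_set; rewrite /= rmorph1; apply/set_mem.
  - move=> /set_mem Sw /set_mem Sz; apply/mem_set; rewrite /= rmorphB.
    by apply/set_mem/SB; apply/mem_set.
  - move=> /set_mem Sw /set_mem Sz; apply/mem_set; rewrite /= fmorph_div.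
    by apply/set_mem/SD; apply/mem_set.
move=> w [[c _ <-]|[n w_pre]]; apply: S_gen.
  by left; rewrite s_fix; exists c.
by right; exists n; rewrite -(s_fix alpha); apply: fixes_iter_value.
Qed.

Lemma restrict_to_K_infty (s : {rmorphism E -> E}) : fixes iota s ->
  exists g : {rmorphism K_infty iota phi alpha -> K_infty iota phi alpha},
    galois_group (@K_infty_incl K E iota phi alpha) g /\
    forall x, generated_val (g x) = s (generated_val x).
Proof.
move=> s_fix; have [s' [s'_fix sK s'K]] := fixes_inverse iota_alg s_fix.
pose L : fieldType := K_infty iota phi alpha.
pose res (t : {rmorphism E -> E}) (t_fix : fixes iota t) (x : L) : L :=
  GeneratedField (fixes_generated t_fix (generated_valP x)).
have resB : zmod_morphism (res s s_fix).
  by move=> x y; apply/val_inj; apply: rmorphB.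
have resM : monoid_morphism (res s s_fix).
  by split=> [|x y]; apply/val_inj; [apply: rmorph1 | apply: rmorphM].
pose gB := GRing.isZmodMorphism.Build _ _ _ resB.
pose gM := GRing.isMonoidMorphism.Build _ _ _ resM.
pose g : {rmorphism L -> L} := HB.pack (res s s_fix) gB gM.
exists g; split=> //; split.
  by exists (res s' s'_fix) => x; apply/val_inj; [apply: sK | apply: s'K].
by move=> c; apply/val_inj; apply: s_fix.
Qed.

Lemma abelian_fixes_commute :
  abelian_automorphisms (galois_group (@K_infty_incl K E iota phi alpha)) ->
  forall s t n x, fixes iota s -> fixes iota t -> iter_value iota phi n x (iota alpha) ->
    s (t x) = t (s x).
Proof.
move=> abel s t n x s_fix t_fix x_pre.
have [gs [gs_gal gsE]] := restrict_to_K_infty s_fix.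
have [gt [gt_gal gtE]] := restrict_to_K_infty t_fix.
have x_gen : K_infty_generators iota phi alpha x by right; exists n.
have := abel gs gt gs_gal gt_gal (GeneratedField (sub_generated x_gen)).
by move=> /(congr1 val) /=; rewrite gsE gtE gtE gsE.
Qed.

Section Preimages.
Variables (O : valuation_subring E) (f1 f2 : {poly K}) (e : nat).
Hypotheses (f1_mon : f1 \is monic) (f2_mon : f2 \is monic).
Hypothesis f1O : map_poly iota f1 \is a polyOver O.
Hypothesis f2O : map_poly iota f2 \is a polyOver O.
Hypotheses (e_gt0 : (0 < e)%N) (deg_e : (size f1).-1 = ((size f2).-1 + e)%N).
Hypothesis phiE : phi = FracField.tofrac f1 / FracField.tofrac f2.

Lemma large_iterated_preimage n : iota alpha \notin O ->
  exists x, [/\ x \notin O, iter_value iota phi n x (iota alpha)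
    & congr O (x ^+ (e ^ n) / iota alpha) 1].
Proof.
move=> alphaO; have [alpha_neq0 _] := notin_val alphaO.
elim: n => [|n [y [yO y_pre y1]]].
  by exists (iota alpha); rewrite expr1 divff //; split=> //; apply: congr_refl.
have mon1 : map_poly iota f1 \is monic by rewrite map_monic.
have mon2 : map_poly iota f2 \is monic by rewrite map_monic.
have deg : (size (map_poly iota f1)).-1 = ((size (map_poly iota f2)).-1 + e)%N.
  by rewrite !size_map_poly.
have [x [xO f2x xy x1]] := large_preimage mon1 f1O mon2 f2O e_gt0 deg yO.
exists x; split=> //; first by exists y => //; exists f1, f2.
have [y_neq0 _] := notin_val yO.
have -> : x ^+ (e ^ n.+1) / iota alpha =
    (x ^+ e / y) ^+ (e ^ n) * (y ^+ (e ^ n) / iota alpha).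
  by rewrite expr_div_n -exprM expnS mulrA divfK ?expf_neq0.
rewrite -[1]mulr1 congrM ?rpred1 //; first exact: congr_int y1 (rpred1 _).
by rewrite -(expr1n _ (e ^ n)) congrX ?rpred1.
Qed.

End Preimages.

End GaloisOfKInfty.

Lemma not_abelian_finite_over_local (R : realType) (B K : fieldType)
    (vB : B -> R) (v : K -> R) (j : {rmorphism B -> K}) (p s D : nat) (r : R)
    (e : nat) (phi : {fraction {poly K}}) (alpha : K)
    (E : closedFieldType) (iota : {rmorphism K -> E}) :
  finite_over_local vB v j p s D r ->
  (2 <= e)%N -> invertible_integer v e%:R -> superattracting_integral v e phi ->
  1 < v alpha -> algebraic_closure iota ->
  ~ abelian_automorphisms (galois_group (@K_infty_incl K E iota phi alpha)).
Proof.
move=> K_local e_ge2 [e_le1 [e' e'_le1 ee']] [f1 [f2 [[f1_mon f1O] [f2_mon f2O] deg_e phiE]]].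
move=> alpha_gt1 iota_alg abel.
have v_abs := top_abs K_local; have p_prime := residue_prime K_local.
pose O := closure_integers K_local iota_alg.
have OE := closure_integersE K_local iota_alg.
have e_gt0 : (0 < e)%N by apply: ltnW.
have ve1 : v e%:R = 1.
  have vee' : v e%:R * v e' = 1 by rewrite -(absM v_abs) ee' (abs1 v_abs).
  apply/eqP; rewrite eq_le (e_le1 : v e%:R <= 1) /= -[X in X <= _]vee'.
  by rewrite ler_piMr // (abs_ge0 v_abs).
have p_ndvd_e : ~~ (p %| e)%N.
  apply/negP => /dvdnP[k ek].
  have p_lt1 : v p%:R < 1.
    by rewrite -(rmorph_nat j) (top_extends K_local) (residue_char K_local).
  have k_le1 : v k%:R <= 1.
    rewrite -OE rmorph_nat.
    exact: rpred_nat.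
  move: ve1; rewrite ek natrM (absM v_abs) => /eqP; rewrite lt_eqF //.
  by rewrite (le_lt_trans _ p_lt1) // ler_piMl // (abs_ge0 v_abs).
have alpha_neq0 : alpha != 0 by apply: contraTneq alpha_gt1 => ->; rewrite (abs0 v_abs) ltr10.
have alphaO : iota alpha \notin O by rewrite OE -ltNge.
have polyO (f : {poly K}) : f \is a polyOver (integers v) -> map_poly iota f \is a polyOver O.
  move=> /polyOverP fO; apply/polyOverP => i; rewrite coef_map /= OE.
  exact: fO.
have [m alpha_m] := discrete_power K_local iota_alg alpha_neq0.
set t := (s * D`!)%N; pose q := (p ^ t)%N.
have q_gt1 : (1 < q)%N.
  rewrite -(exp1n t) ltn_exp2r ?prime_gt1 // muln_gt0 (residue_degree K_local).
  exact: fact_gt0.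
have /andP[r_gt0 r_lt1] := uniformizer K_local.
have m_neq0 : m != 0.
  apply/eqP => m0; have : 1 < v alpha ^+ D`! by rewrite exprn_egt1 // -lt0n fact_gt0.
  by rewrite alpha_m m0 expr0z ltxx.
(* e ^ n will divide this positive integer, although e ^ n > n. *)
pose n := (`|m| * q.-1)%N.
have [x [xO x_pre x1]] := large_iterated_preimage f1_mon f2_mon (polyO _ f1O)
  (polyO _ f2O) e_gt0 deg_e phiE n alphaO.
have [x_neq0 _] := notin_val xO.
have N_unit : (e ^ n)%:R \notin nonunits O.
  rewrite -(rmorph_nat iota) (closure_nonunitsE K_local iota_alg) natrX.
  by rewrite (absX v_abs) ve1 expr1n ltxx.
have N_gt0 : (0 < e ^ n)%N by rewrite expn_gt0 e_gt0.
have [a [c [c_neq0]]] := commuting_value iota_alg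
  (@closure_integers_fixes _ _ _ _ _ _ _ _ _ _ K_local _ _ iota_alg) p_prime
  (residue_char_nonunit K_local iota_alg) N_gt0 N_unit
  (fun b => @residue_power _ _ _ _ _ _ _ _ _ _ K_local _ _ iota_alg b) x_neq0 alpha_neq0 x1
  (fun s1 s2 s1_fix s2_fix => abelian_fixes_commute iota_alg abel s1_fix s2_fix x_pre).
rewrite (closure_unitsE K_local iota_alg) (absM v_abs) (absV v_abs) !(absX v_abs).
move=> /eqP val_eq.
have [k c_k] := discrete_power K_local iota_alg c_neq0.
have vc_neq0 : v c ^+ (e ^ n) != 0 by rewrite expf_neq0 // gt_eqF // (abs_gt0 v_abs).
have {val_eq} val_eq : v alpha ^+ (p ^ a * q.-1) = v c ^+ (e ^ n).
  by rewrite -[LHS](divfK vc_neq0) val_eq mul1r.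
have mk : m * (p ^ a * q.-1)%:Z = k * (e ^ n)%:Z.
  apply: (@ieexprIz _ r) => //; first by rewrite lt_eqF.
  by rewrite -!exprz_exp -alpha_m -c_k -!exprnP exprAC val_eq exprAC.
have N_dvd : (e ^ n %| `|m| * q.-1)%N.
  have : (e ^ n %| p ^ a * (`|m| * q.-1))%N.
    rewrite mulnCA -[X in (_ * X)%N]/(`|(p ^ a * q.-1)%:Z|%N) -abszM mk abszM /=.
    exact: dvdn_mull.
  rewrite Gauss_dvdr // coprimeXl // coprimeXr // coprime_sym prime_coprime //.
have n_gt0 : (0 < `|m| * q.-1)%N.
  by rewrite muln_gt0 absz_gt0 m_neq0 -ltnS prednK // ltnW.
by have := dvdn_leq n_gt0 N_dvd; rewrite leqNgt ltn_expl.
Qed.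

Theorem corollary4p12 (R : realType) (K : fieldType) (v : K -> R)
    (Klocal : local_field v)
    (e : nat) (e_ge2 : (2 <= e)%N) (e_inv : invertible_integer v e%:R)
    (phi : {fraction {poly K}}) (phi_int : superattracting_integral v e phi)
    (alpha : K) (alpha_gt1 : 1 < v alpha)
    (Kbar : closedFieldType) (iota : {rmorphism K -> Kbar})
    (Kbar_alg : algebraic_closure iota) :
  ~ abelian_automorphisms
      (galois_group (@K_infty_incl K Kbar iota phi alpha)).
Proof.
case: Klocal => [p c Qp vp L f p_prime c01 Qp_padic f_bij v_abs v_ext
                |Fq c f c01 f_bij fD fM v0 v_order].
  have K_fin := padic_finite_over_local p_prime c01 Qp_padic f_bij v_abs v_ext.
  exact: not_abelian_finite_over_local K_fin e_ge2 e_inv phi_int alpha_gt1 Kbar_alg.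
have [p [s K_fin]] := laurent_finite_over_local c01 f_bij fD fM v0 v_order.
exact: not_abelian_finite_over_local K_fin e_ge2 e_inv phi_int alpha_gt1 Kbar_alg.
Qed.
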